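(* Let $\mathcal C$ be a small category and let $R\colon\mathcal C\to\mathrm{Ring}$ be a strict representation. Then the Yoneda functor $Y\colon\mathrm{Mod}\text{-}R\to\mathrm{Mod}\text{-}R_{fp}$ induces equivalences of categories $$\mathrm{Mod}\text{-}R\cong\mathrm{L.Flat}(\mathrm{Mod}\text{-}R_{fp})\quad\text{and}\quad\mathrm{Mod}_{\mathrm{cart}}(R)\cong\mathrm{L.Flat}(\mathrm{Mod}_{\mathrm{cart}}(R_{fp})).$$
   Context: $\mathrm{Ring}$ is the category of unitary associative rings, a full subcategory of the category $\mathrm{Add}$ of small preadditive categories. For a (skeletally) small preadditive category $A$, $(A^{op},\mathrm{Ab})$ is the category of additive functors $A^{op}\to\mathrm{Ab}$ (right $A$-modules); such an $M$ is flat if $M\otimes_A-\colon(A,\mathrm{Ab})\to\mathrm{Ab}$ is exact, and $\mathrm{Flat}(A^{op},\mathrm{Ab})$ is the full subcategory of flat functors. For an additive functor $\phi\colon A\to B$, $\phi^*$ is precomposition with $\phi$ and $\phi_!=-\otimes_A\mathrm{Hom}_B(-,\phi(-))$ is its left adjoint. Modules over a pseudofunctor. Let $S\colon\mathcal C\to\mathrm{Add}$ be a pseudofunctor (representation), with coherence isomorphisms $\delta_c\colon\mathrm{id}_{S_c}\to S_{\mathrm{id}_c}$ and $\mu_{\beta,\alpha}\colon S_\beta S_\alpha\to S_{\beta\alpha}$; it is strict if it is a functor with $\delta,\mu$ identities. Write $(\alpha_!,\alpha^* )$ for the adjunction induced by $S_\alpha$. A right $S$-module $M$ consists of $M_c\in(S_c^{op},\mathrm{Ab})$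 for each object $c$ and morphisms $M_\alpha\colon M_c\to\alpha^*M_d$ for each $\alpha\colon c\to d$ such that $(M_\beta)_{S_\alpha(a)}\circ(M_\alpha)_a=M_e((\mu_{\beta,\alpha})_a)\circ(M_{\beta\alpha})_a$ and $M_c((\delta_c)_a)\circ(M_{\mathrm{id}_c})_a=\mathrm{id}$ for all $\alpha\colon c\to d$, $\beta\colon d\to e$, $a\in\mathrm{Ob}S_c$. Morphisms $\phi\colon M\to N$ are families $\phi_c\colon M_c\to N_c$ with $N_\alpha\circ\phi_c=\alpha^*(\phi_d)\circ M_\alpha$. The category is $\mathrm{Mod}\text{-}S$; $\mathrm{Mod}_{\mathrm{cart}}(S)$ is the full subcategory of cartesian modules, i.e. those for which the adjoint $\alpha_!(M_c)\to M_d$ of $M_\alpha$ is an isomorphism for every $\alpha\colon c\to d$. The induced representation $R_{fp}\colon\mathcal C\to\mathrm{Add}$ of a strict $R\colon\mathcal C\to\mathrm{Ring}$: $R_{fp}(c)=\mathrm{mod}\text{-}R_c$ (finitely presented right $R_c$-modules); $R_{fp}(\alpha)=-\otimes_{R_c}R_d$ for $\alpha\colon c\to d$; $\mu_{\beta,\alpha}\colon(F\otimes_{R_c}R_d)\otimes_{R_d}R_e\to F\otimes_{R_c}R_e$ is $(f\otimes r_1)\otimes r_2\mapsto f\otimes R_\beta(r_1)r_2$; $(\delta_c)_F\colon F\to F\otimes_{R_c}R_c$ is $f\mapsto f\otimes1$. The functor $Y\colon\mathrm{Mod}\text{-}R\to\mathrm{Mod}\text{-}R_{fp}$: $Y(M)_c=\mathrm{Hom}_{R_c}(-,M_c)|_{\mathrm{mod}\text{-}R_c}$;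 for $\alpha\colon c\to d$ and $F\in\mathrm{mod}\text{-}R_c$, $Y(M)_\alpha$ sends $f\in\mathrm{Hom}_{R_c}(F,M_c)$ to the morphism in $\mathrm{Hom}_{R_d}(F\otimes_{R_c}R_d,M_d)$ adjoint to $M_\alpha\circ f\colon F\to\alpha^*M_d$; and $Y(\phi)_c=\mathrm{Hom}_{R_c}(-,\phi_c)|_{\mathrm{mod}\text{-}R_c}$. $\mathrm{L.Flat}(\mathrm{Mod}\text{-}R_{fp})$ (resp. $\mathrm{L.Flat}(\mathrm{Mod}_{\mathrm{cart}}(R_{fp}))$) is the full subcategory of $\mathrm{Mod}\text{-}R_{fp}$ (resp. $\mathrm{Mod}_{\mathrm{cart}}(R_{fp})$) of the modules $M$ with $M_c\in\mathrm{Flat}((\mathrm{mod}\text{-}R_c)^{op},\mathrm{Ab})$ for all $c\in\mathrm{Ob}\,\mathcal C$. *)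

(* Defs.v *)
From HB Require Import structures.
From mathcomp Require Import all_boot all_algebra.
From mathcomp Require Import boolp.

Set Implicit Arguments.
Unset Strict Implicit.
Unset Printing Implicit Defensive.

Import GRing.Theory.
Local Open Scope ring_scope.
Local Open Scope quotient_scope.

Record category := Category {
  obj :> Type;
  hom : obj -> obj -> Type;
  idm : forall a, hom a a;
  comp : forall a b c, hom b c -> hom a b -> hom a c;
  comp1m : forall a b (f : hom a b), comp (idm b) f = f;
  compm1 : forall a b (f : hom a b), comp f (idm a) = f;
  compA : forall a b c d (h : hom c d) (g : hom b c) (f : hom a b),
    comp h (comp g f) = comp (comp h g) f
}.
Arguments hom {C} a b : rename.
Arguments idm {C} a : rename.
Arguments comp {C} [a b c] g f : rename.

Record functor (C D : category) := Functor {
  fobj :> C -> D;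
  fmap : forall a b, hom a b -> hom (fobj a) (fobj b);
  fmap1 : forall a, fmap (idm a) = idm (fobj a);
  fmapM : forall a b c (g : hom b c) (f : hom a b),
    fmap (comp g f) = comp (fmap g) (fmap f)
}.
Arguments fmap {C D} F [a b] f : rename.

Definition id_functor (C : category) : functor C C :=
  @Functor C C id (fun _ _ f => f) (fun _ => erefl) (fun _ _ _ _ _ => erefl).

Lemma comp_functor_id C D E (G : functor D E) (F : functor C D) (a : C) :
  fmap G (fmap F (idm a)) = idm (G (F a)).
Proof. by rewrite !fmap1. Qed.

Lemma comp_functor_comp C D E (G : functor D E) (F : functor C D)
    (a b c : C) (g : hom b c) (f : hom a b) :
  fmap G (fmap F (comp g f)) = comp (fmap G (fmap F g)) (fmap G (fmap F f)).
Proof. by rewrite !fmapM. Qed.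

Definition comp_functor C D E (G : functor D E) (F : functor C D) :
    functor C E :=
  @Functor C E (fun a => G (F a)) (fun a b f => fmap G (fmap F f))
    (comp_functor_id G F) (comp_functor_comp G F).

Definition is_iso (C : category) (a b : C) (f : hom a b) : Prop :=
  exists g : hom b a, comp g f = idm a /\ comp f g = idm b.

Definition naturally_isomorphic C D (F G : functor C D) : Prop :=
  exists t : forall a, hom (F a) (G a),
    (forall a b (f : hom a b), comp (t b) (fmap F f) = comp (fmap G f) (t a)) /\
    (forall a, is_iso (t a)).

Definition is_equivalence C D (F : functor C D) : Prop :=
  exists G : functor D C,
    naturally_isomorphic (comp_functor G F) (id_functor C) /\
    naturally_isomorphic (comp_functor F G) (id_functor D).

Definition full_subcategory (C : category) (P : C -> Prop) : category :=
  @Category {a : C | P a} (fun a b => hom (sval a) (sval b))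
    (fun a => idm (sval a)) (fun a b c g f => comp g f)
    (fun a b f => comp1m f) (fun a b f => compm1 f)
    (fun a b c d h g f => compA h g f).

Definition corestriction C D (F : functor C D) (Q : D -> Prop)
    (FQ : forall a, Q (F a)) : functor C (full_subcategory Q) :=
  @Functor C (full_subcategory Q) (fun a => exist Q (F a) (FQ a))
    (fun a b f => fmap F f) (fun a => fmap1 F a)
    (fun a b c g f => fmapM F g f).

Definition restriction C D (F : functor C D) (P : C -> Prop) (Q : D -> Prop)
    (PQ : forall a, P a -> Q (F a)) :
    functor (full_subcategory P) (full_subcategory Q) :=
  @Functor (full_subcategory P) (full_subcategory Q)
    (fun a => exist Q (F (sval a)) (PQ (sval a) (proj2_sig a)))
    (fun a b f => fmap F f) (fun a => fmap1 F (sval a))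
    (fun a b c g f => fmapM F g f).

Record preadd := Preadd {
  pobj :> Type;
  phom : pobj -> pobj -> zmodType;
  pid : forall a, phom a a;
  pcomp : forall a b c, phom b c -> phom a b -> phom a c;
  pcomp1m : forall a b (f : phom a b), pcomp (pid b) f = f;
  pcompm1 : forall a b (f : phom a b), pcomp f (pid a) = f;
  pcompA : forall a b c d (h : phom c d) (g : phom b c) (f : phom a b),
    pcomp h (pcomp g f) = pcomp (pcomp h g) f;
  pcompDl : forall a b c (g g' : phom b c) (f : phom a b),
    pcomp (g + g') f = pcomp g f + pcomp g' f;
  pcompDr : forall a b c (g : phom b c) (f f' : phom a b),
    pcomp g (f + f') = pcomp g f + pcomp g f'
}.
Arguments phom {A} a b : rename.
Arguments pid {A} a : rename.
Arguments pcomp {A} [a b c] g f : rename.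

Record add_functor (A B : preadd) := AddFunctor {
  afobj :> A -> B;
  afmap : forall a b, {additive phom a b -> phom (afobj a) (afobj b)};
  afmap1 : forall a, afmap a a (pid a) = pid (afobj a);
  afmapM : forall a b c (g : phom b c) (f : phom a b),
    afmap a c (pcomp g f) = pcomp (afmap b c g) (afmap a b f)
}.
Arguments afmap {A B} phi {a b} : rename.

Definition piso (A : preadd) (a b : A) (f : phom a b) : Prop :=
  exists g : phom b a, pcomp g f = pid a /\ pcomp f g = pid b.

(* Additive functors A^op -> Ab, that is, right A-modules. *)
Record rmod (A : preadd) := RMod {
  rmobj :> A -> zmodType;
  ract : forall a b, phom a b -> {additive rmobj b -> rmobj a};
  ractD : forall a b (f g : phom a b) x, ract (f + g) x = ract f x + ract g x;
  ract1 : forall a x, ract (pid a) x = x;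
  ractM : forall a b c (g : phom b c) (f : phom a b) x,
    ract (pcomp g f) x = ract f (ract g x)
}.
Arguments ract {A} M [a b] f : rename.

Record rhom (A : preadd) (M N : rmod A) := RHom {
  rhfun :> forall a, {additive M a -> N a};
  rhnat : forall a b (f : phom a b) x, rhfun a (ract M f x) = ract N f (rhfun b x)
}.

(* Additive functors A -> Ab, that is, left A-modules. *)
Record lmod (A : preadd) := LMod {
  lmobj :> A -> zmodType;
  lact : forall a b, phom a b -> {additive lmobj a -> lmobj b};
  lactD : forall a b (f g : phom a b) x, lact (f + g) x = lact f x + lact g x;
  lact1 : forall a x, lact (pid a) x = x;
  lactM : forall a b c (g : phom b c) (f : phom a b) x,
    lact (pcomp g f) x = lact g (lact f x)
}.
Arguments lact {A} N [a b] f : rename.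

Record lhom (A : preadd) (M N : lmod A) := LHom {
  lhfun :> forall a, {additive M a -> N a};
  lhnat : forall a b (f : phom a b) x, lhfun b (lact M f x) = lact N f (lhfun a x)
}.

(* The smallest congruence containing [rel] on the free commutative monoid on
   [T], whose elements are written as lists.  For the relations used below the
   quotient is an abelian group: negation is [x (x) y |-> (- x) (x) y]. *)
Inductive sum_congr (T : Type) (rel : seq T -> seq T -> Prop) :
    seq T -> seq T -> Prop :=
| sc_base u v of rel u v : sum_congr rel u v
| sc_refl u : sum_congr rel u u
| sc_sym u v of sum_congr rel u v : sum_congr rel v u
| sc_trans u v w of sum_congr rel u v & sum_congr rel v w : sum_congr rel u w
| sc_cat u u' v v' of sum_congr rel u u' & sum_congr rel v v' :
    sum_congr rel (u ++ v) (u' ++ v')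
| sc_comm u v : sum_congr rel (u ++ v) (v ++ u).

Section Tensor.
Variables (A : preadd) (M : rmod A).

(* A representative of an element of the coend M (x)_A N, which is a quotient
   of the direct sum of the groups M a (x)_Z N a.  The coend is handled through
   representatives because [A] need only be skeletally small, so that the
   carrier of the quotient need not live in the universe of [zmodType]. *)
Definition tsum (N : lmod A) := seq {a : A & (M a * N a)%type}.

Definition tgen (N : lmod A) (a : A) (x : M a) (y : N a) :
    {a : A & (M a * N a)%type} :=
  existT (fun a => (M a * N a)%type) a (x, y).

Inductive trel (N : lmod A) : tsum N -> tsum N -> Prop :=
| trel_Dl a (x x' : M a) (y : N a) :
    trel [:: tgen (x + x') y] [:: tgen x y; tgen x' y]
| trel_Dr a (x : M a) (y y' : N a) :
    trel [:: tgen x (y + y')] [:: tgen x y; tgen x y']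
| trel_0 a (y : N a) : trel [:: tgen 0 y] [::]
| trel_bal a b (f : phom a b) (x : M b) (y : N a) :
    trel [:: tgen (ract M f x) y] [:: tgen x (lact N f y)].

Definition teq (N : lmod A) : tsum N -> tsum N -> Prop := sum_congr (@trel N).

Definition tmap (N N' : lmod A) (f : lhom N N') (u : tsum N) : tsum N' :=
  [seq tgen (tagged g).1 (f _ (tagged g).2) | g <- u].

Lemma tmap_teq (N N' : lmod A) (f : lhom N N') (u v : tsum N) :
  teq u v -> teq (tmap f u) (tmap f v).
Proof.
rewrite /teq; elim => {u v}.
- move=> u v [a x x' y|a x y y'|a y|a b h x y] /=; apply: sc_base.
  + exact: trel_Dl.
  + rewrite /tmap /= raddfD; exact: trel_Dr.
  + exact: trel_0.
  + rewrite /tmap /= lhnat; exact: trel_bal.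
- by move=> u; exact: sc_refl.
- by move=> u v _; exact: sc_sym.
- by move=> u v w _ + _; exact: sc_trans.
- by move=> u u' v v' _ iu _ iv; rewrite /tmap !map_cat; exact: sc_cat.
- by move=> u v; rewrite /tmap !map_cat; exact: sc_comm.
Qed.

End Tensor.

Definition short_exact (A : preadd) (N1 N2 N3 : lmod A)
    (f : lhom N1 N2) (g : lhom N2 N3) : Prop :=
  forall a, [/\ injective (f a),
    forall y, g a y = 0 <-> exists x, y = f a x &
    forall z, exists y, g a y = z].

(* Short exactness of M (x) N1 -> M (x) N2 -> M (x) N3. *)
Definition tensor_short_exact (A : preadd) (M : rmod A) (N1 N2 N3 : lmod A)
    (f : lhom N1 N2) (g : lhom N2 N3) : Prop :=
  [/\ forall u v : tsum M N1, teq (tmap f u) (tmap f v) -> teq u v,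
    forall v : tsum M N2,
      teq (tmap g v) [::] <-> exists u : tsum M N1, teq v (tmap f u) &
    forall w : tsum M N3, exists v : tsum M N2, teq (tmap g v) w].

Definition flat (A : preadd) (M : rmod A) : Prop :=
  forall (N1 N2 N3 : lmod A) (f : lhom N1 N2) (g : lhom N2 N3),
    short_exact f g -> tensor_short_exact M f g.

Section ChangeOfBase.
Variables (A B : preadd) (phi : add_functor A B).

Lemma pull_ractD (M : rmod B) (a b : A) (f g : phom a b) x :
  ract M (afmap phi (f + g)) x = ract M (afmap phi f) x + ract M (afmap phi g) x.
Proof. by rewrite raddfD ractD. Qed.
Lemma pull_ract1 (M : rmod B) (a : A) x : ract M (afmap phi (pid a)) x = x.
Proof. by rewrite afmap1 ract1. Qed.
Lemma pull_ractM (M : rmod B) (a b c : A) (g : phom b c) (f : phom a b) x :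
  ract M (afmap phi (pcomp g f)) x = ract M (afmap phi f) (ract M (afmap phi g) x).
Proof. by rewrite afmapM ractM. Qed.

Definition pull (M : rmod B) : rmod A :=
  @RMod A (fun a => M (phi a)) (fun a b f => ract M (afmap phi f))
    (@pull_ractD M) (@pull_ract1 M) (@pull_ractM M).

Section Corepresentable.
Variable b : B.

Section Act.
Variables (a a' : A) (f : phom a a').
Definition corep_act (h : phom b (phi a)) : phom b (phi a') :=
  pcomp (afmap phi f) h.
Lemma corep_act_additive : zmod_morphism corep_act.
Proof.
move=> h k; rewrite /corep_act; apply/eqP.
by rewrite eq_sym subr_eq -pcompDr subrK.
Qed.
HB.instance Definition _ :=
  GRing.isZmodMorphism.Build _ _ corep_act corep_act_additive.
End Act.

Lemma corep_actD (a a' : A) (f g : phom a a') x :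
  corep_act (f + g) x = corep_act f x + corep_act g x.
Proof. by rewrite /corep_act raddfD pcompDl. Qed.
Lemma corep_act1 (a : A) x : corep_act (pid a) x = x.
Proof. by rewrite /corep_act afmap1 pcomp1m. Qed.
Lemma corep_actM (a a' a'' : A) (g : phom a' a'') (f : phom a a') x :
  corep_act (pcomp g f) x = corep_act g (corep_act f x).
Proof. by rewrite /corep_act afmapM pcompA. Qed.

(* The left A-module Hom_B(b, phi(-)). *)
Definition corep : lmod A :=
  @LMod A (fun a => phom b (phi a)) (fun a a' f => corep_act f)
    corep_actD corep_act1 corep_actM.
End Corepresentable.

Variables (M : rmod A) (N : rmod B) (f : rhom M (pull N)).

(* The component at [b] of the adjoint phi_! M -> N of [f], on representatives
   of (phi_! M)(b) = M (x)_A Hom_B(b, phi(-)). *)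
Definition adjoint (b : B) (u : tsum M (corep b)) : N b :=
  \sum_(g <- u) ract N (tagged g).2 (f _ (tagged g).1).

Lemma adjoint_teq (b : B) (u v : tsum M (corep b)) :
  teq u v -> adjoint u = adjoint v.
Proof.
rewrite /teq; elim => {u v} //.
- move=> u v [a x x' y|a x y y'|a y|a a' h x y] /=;
    rewrite /adjoint !big_cons !big_nil /= ?addr0.
  + by rewrite !raddfD.
  + by rewrite ractD.
  + by rewrite !raddf0.
  + by rewrite /corep_act ractM rhnat.
- by move=> u v w _ -> _ ->.
- by move=> u u' v v' _ iu _ iv; rewrite /adjoint !big_cat; congr (_ + _).
- by move=> u v; rewrite /adjoint !big_cat /= addrC.
Qed.

Definition adjoint_is_iso : Prop :=
  forall b : B,
    (forall u v : tsum M (corep b), adjoint u = adjoint v -> teq u v) /\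
    (forall y : N b, exists u : tsum M (corep b), adjoint u = y).

End ChangeOfBase.

Section Cast.
Variables (C : category) (S : C -> preadd).
Variable Smap : forall c d, hom c d -> add_functor (S c) (S d).
(* The identification of S_alpha with S_beta for equal alpha and beta. *)
Definition rep_cast c d (al be : hom c d) (e : al = be) (a : S c) :
    phom (Smap al a) (Smap be a) :=
  match e in _ = x return phom (Smap al a) (Smap x a) with
  | erefl => pid (Smap al a)
  end.
End Cast.

(* Pseudofunctors C -> Add.  The coherence laws compare S at provably equal
   morphisms of C, hence the casts. *)
Record representation (C : category) := Representation {
  rep_obj :> C -> preadd;
  rep_map : forall c d, hom c d -> add_functor (rep_obj c) (rep_obj d);
  rep_delta : forall c (a : rep_obj c), phom a (rep_map (idm c) a);
  rep_mu : forall c d e (be : hom d e) (al : hom c d) (a : rep_obj c),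
    phom (rep_map be (rep_map al a)) (rep_map (comp be al) a);
  rep_delta_iso : forall c (a : rep_obj c), piso (rep_delta a);
  rep_mu_iso : forall c d e (be : hom d e) (al : hom c d) (a : rep_obj c),
    piso (rep_mu be al a);
  rep_delta_nat : forall c (a b : rep_obj c) (f : phom a b),
    pcomp (rep_delta b) f = pcomp (afmap (rep_map (idm c)) f) (rep_delta a);
  rep_mu_nat : forall c d e (be : hom d e) (al : hom c d) (a b : rep_obj c)
      (f : phom a b),
    pcomp (rep_mu be al b) (afmap (rep_map be) (afmap (rep_map al) f)) =
    pcomp (afmap (rep_map (comp be al)) f) (rep_mu be al a);
  rep_unitl : forall c d (al : hom c d) (a : rep_obj c),
    pcomp (rep_cast rep_map (comp1m al) a)
      (pcomp (rep_mu (idm d) al a) (rep_delta (rep_map al a))) =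
    pid (rep_map al a);
  rep_unitr : forall c d (al : hom c d) (a : rep_obj c),
    pcomp (rep_cast rep_map (compm1 al) a)
      (pcomp (rep_mu al (idm c) a) (afmap (rep_map al) (rep_delta a))) =
    pid (rep_map al a);
  rep_assoc : forall c d e f (ga : hom e f) (be : hom d e) (al : hom c d)
      (a : rep_obj c),
    pcomp (rep_cast rep_map (compA ga be al) a)
      (pcomp (rep_mu ga (comp be al) a) (afmap (rep_map ga) (rep_mu be al a))) =
    pcomp (rep_mu (comp ga be) al a) (rep_mu ga be (rep_map al a))
}.
Arguments rep_map {C} S [c d] al : rename.
Arguments rep_delta {C} S [c] a : rename.
Arguments rep_mu {C} S [c d e] be al a : rename.

Record smod (C : category) (S : representation C) := SMod {
  smobj :> forall c, rmod (S c);
  smmap : forall c d (al : hom c d), rhom (smobj c) (pull (rep_map S al) (smobj d));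
  sm_mu : forall c d e (be : hom d e) (al : hom c d) (a : S c) (x : smobj c a),
    smmap be (rep_map S al a) (smmap al a x) =
    ract (smobj e) (rep_mu S be al a) (smmap (comp be al) a x);
  sm_delta : forall c (a : S c) (x : smobj c a),
    ract (smobj c) (rep_delta S a) (smmap (idm c) a x) = x
}.
Arguments smmap {C S} M [c d] al : rename.

Record shom (C : category) (S : representation C) (M N : smod S) := SHom {
  shfun :> forall c, rhom (M c) (N c);
  shnat : forall c d (al : hom c d) (a : S c) (x : M c a),
    smmap N al a (shfun c a x) = shfun d (rep_map S al a) (smmap M al a x)
}.

Lemma additive_ext (U V : zmodType) (f g : {additive U -> V}) : f =1 g -> f = g.
Proof.
case: f => f [[f0]]; case: g => g [[g0]] /= fg.
have e : f = g by apply: functional_extensionality_dep.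
by case: _ / e in g0 fg *; rewrite (Prop_irrelevance f0 g0).
Qed.

Lemma rhom_ext (A : preadd) (M N : rmod A) (f g : rhom M N) :
  (forall a x, f a x = g a x) -> f = g.
Proof.
case: f => f f0; case: g => g g0 /= fg.
have e : f = g.
  by apply: functional_extensionality_dep => a; apply: additive_ext => x; exact: fg.
by move: f0 g0; rewrite e => f0 g0; rewrite (Prop_irrelevance f0 g0).
Qed.

Lemma shom_ext (C : category) (S : representation C) (M N : smod S)
  (f g : shom M N) : (forall c a x, f c a x = g c a x) -> f = g.
Proof.
case: f => f f0; case: g => g g0 /= fg.
have e : f = g.
  by apply: functional_extensionality_dep => c; apply: rhom_ext => a x; exact: fg.
by move: f0 g0; rewrite e => f0 g0; rewrite (Prop_irrelevance f0 g0).
Qed.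

Definition rhom_id (A : preadd) (M : rmod A) : rhom M M :=
  @RHom A M M (fun a => idfun : {additive M a -> M a})
    (fun a b f x => erefl).

Lemma rhom_comp_nat (A : preadd) (M N P : rmod A) (g : rhom N P) (f : rhom M N)
    (a b : A) (h : phom a b) x :
  g a (f a (ract M h x)) = ract P h (g b (f b x)).
Proof. by rewrite !rhnat. Qed.

Definition rhom_comp (A : preadd) (M N P : rmod A) (g : rhom N P) (f : rhom M N) :
    rhom M P :=
  @RHom A M P (fun a => (g a \o f a : M a -> P a) : {additive M a -> P a})
    (rhom_comp_nat g f).

Section ModCategory.
Variables (C : category) (S : representation C).

Definition shom_id (M : smod S) : shom M M :=
  @SHom C S M M (fun c => rhom_id (M c)) (fun _ _ _ _ _ => erefl).

Lemma shom_comp_nat (M N P : smod S) (g : shom N P) (f : shom M N)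
    c d (al : hom c d) (a : S c) (x : M c a) :
  smmap P al a (g c a (f c a x)) =
  g d (rep_map S al a) (f d (rep_map S al a) (smmap M al a x)).
Proof. by rewrite !shnat. Qed.

Definition shom_comp (M N P : smod S) (g : shom N P) (f : shom M N) : shom M P :=
  @SHom C S M P (fun c => rhom_comp (g c) (f c)) (shom_comp_nat g f).

Lemma shom_comp1m (M N : smod S) (f : shom M N) : shom_comp (shom_id N) f = f.
Proof. exact: shom_ext. Qed.
Lemma shom_compm1 (M N : smod S) (f : shom M N) : shom_comp f (shom_id M) = f.
Proof. exact: shom_ext. Qed.
Lemma shom_compA (M N P Q : smod S) (h : shom P Q) (g : shom N P) (f : shom M N) :
  shom_comp h (shom_comp g f) = shom_comp (shom_comp h g) f.
Proof. exact: shom_ext. Qed.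

Definition Mod : category :=
  @Category (smod S) (@shom C S) shom_id shom_comp
    shom_comp1m shom_compm1 shom_compA.

Definition cartesian (M : Mod) : Prop :=
  forall c d (al : hom c d), adjoint_is_iso (smmap (M : smod S) al).

Definition Mod_cart : category := full_subcategory cartesian.

Definition locally_flat (M : Mod) : Prop := forall c, flat ((M : smod S) c).

Definition LFlat : category := full_subcategory locally_flat.

Definition LFlat_cart : category :=
  full_subcategory (fun M : Mod_cart => locally_flat (sval M)).

End ModCategory.

(* Strict representations C -> Ring, that is, functors; [pzRingType] is the
   class of unitary associative rings, the zero ring included. *)
Record ring_rep (C : category) := RingRep {
  rr_obj :> C -> pzRingType;
  rr_map : forall c d, hom c d -> {rmorphism rr_obj c -> rr_obj d};
  rr_id : forall c (r : rr_obj c), rr_map (idm c) r = r;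
  rr_comp : forall c d e (be : hom d e) (al : hom c d) (r : rr_obj c),
    rr_map (comp be al) r = rr_map be (rr_map al r)
}.
Arguments rr_map {C} R [c d] al : rename.

Section RingAsCategory.
Variable R : pzRingType.

(* The ring [R] as a preadditive category with one object. *)
Definition ringcat : preadd :=
  @Preadd unit (fun _ _ => R : zmodType) (fun _ => 1) (fun _ _ _ g f => g * f)
    (fun _ _ f => mul1r f) (fun _ _ f => mulr1 f)
    (fun _ _ _ _ h g f => mulrA h g f)
    (fun _ _ _ g g' f => mulrDl g g' f) (fun _ _ _ g f f' => mulrDr g f f').

(* Right modules over the one-object category [R], seen as right R-modules of
   the library, that is, left modules over the converse ring. *)
Variable M : rmod ringcat.
Definition rmod_carrier : Type := M tt.
HB.instance Definition _ := GRing.Zmodule.on rmod_carrier.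

Let scl (r : R^c) (x : rmod_carrier) : rmod_carrier :=
  ract M (r : @phom ringcat tt tt) x.
Lemma scl_A r s x : scl r (scl s x) = scl (r * s) x.
Proof. by rewrite /scl -ractM. Qed.
Lemma scl_1 : left_id 1 scl.
Proof. exact: (ract1 (r := M) (a := tt)). Qed.
Lemma scl_Dr : right_distributive scl +%R.
Proof. by move=> r x y; rewrite /scl raddfD. Qed.
Lemma scl_Dl x : {morph scl^~ x : r s / r + s}.
Proof. by move=> r s; rewrite /scl -ractD. Qed.
HB.instance Definition _ :=
  GRing.Zmodule_isLmodule.Build R^c rmod_carrier scl_A scl_1 scl_Dr scl_Dl.
Definition rmod_lmod : lmodType R^c := rmod_carrier.

End RingAsCategory.

Section RingFunctor.
Variables (R S : pzRingType) (phi : {rmorphism R -> S}).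
Definition ringfun : add_functor (ringcat R) (ringcat S) :=
  @AddFunctor (ringcat R) (ringcat S) (fun _ => tt)
    (fun _ _ => phi : {additive R -> S}) (fun _ => rmorph1 phi)
    (fun _ _ _ g f => rmorphM phi g f).
End RingFunctor.

Section RingRepresentation.
Variables (C : category) (R : ring_rep C).

Let S (c : C) : preadd := ringcat (R c).
Let Smap c d (al : hom c d) : add_functor (S c) (S d) := ringfun (rr_map R al).

Lemma ring_cast c d (al be : hom c d) (e : al = be) (a : S c) :
  rep_cast Smap e a = (1 : R d).
Proof. by case: _ / e. Qed.

Lemma piso1 (c : C) (a b : S c) : @piso (S c) a b (1 : R c).
Proof. by exists (1 : R c); split; exact: mulr1. Qed.

Lemma ring_delta_nat c (a b : S c) (f : phom a b) :
  (1 : R c) * f = rr_map R (idm c) f * 1.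
Proof. by rewrite rr_id mul1r mulr1. Qed.

Lemma ring_mu_nat c d e (be : hom d e) (al : hom c d) (a b : S c) (f : phom a b) :
  1 * rr_map R be (rr_map R al f) = rr_map R (comp be al) f * 1.
Proof. by rewrite rr_comp mul1r mulr1. Qed.

Lemma ring_unitl c d (al : hom c d) (a : S c) :
  (rep_cast Smap (comp1m al) a : R d) * (1 * 1) = 1.
Proof. by rewrite ring_cast !mulr1. Qed.

Lemma ring_unitr c d (al : hom c d) (a : S c) :
  (rep_cast Smap (compm1 al) a : R d) * (1 * rr_map R al 1) = 1.
Proof. by rewrite ring_cast rmorph1 !mulr1. Qed.

Lemma ring_assoc c d e f (ga : hom e f) (be : hom d e) (al : hom c d) (a : S c) :
  (rep_cast Smap (compA ga be al) a : R f) * (1 * rr_map R ga 1) = 1 * 1.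
Proof. by rewrite ring_cast rmorph1 !mulr1. Qed.

(* [R] viewed as a representation C -> Add; delta and mu are identities. *)
Definition ring_representation : representation C :=
  @Representation C S Smap (fun c _ => 1 : R c) (fun _ _ e _ _ _ => 1 : R e)
    (fun c a => piso1 a tt) (fun c d e be al a => @piso1 e tt tt)
    ring_delta_nat ring_mu_nat ring_unitl ring_unitr ring_assoc.

End RingRepresentation.

Lemma linear_ext (R : pzRingType) (U V : lmodType R) (f g : {linear U -> V}) :
  f =1 g -> f = g.
Proof.
case: f => f [[f0] [f1]]; case: g => g [[g0] [g1]] /= fg.
have e : f = g by apply: functional_extensionality_dep.
by case: _ / e in g0 g1 fg *; rewrite (Prop_irrelevance f0 g0) (Prop_irrelevance f1 g1).
Qed.

Section LinearZmod.
Variables (R : pzRingType) (U V : lmodType R).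
HB.instance Definition _ := gen_eqMixin {linear U -> V}.
HB.instance Definition _ := gen_choiceMixin {linear U -> V}.
Implicit Types f g h : {linear U -> V}.

Definition lin0 : {linear U -> V} := \0.
Definition linopp f : {linear U -> V} := \- f.
Definition linadd f g : {linear U -> V} := f \+ g.
Lemma linaddA : associative linadd.
Proof. by move=> f g h; apply: linear_ext => x /=; rewrite addrA. Qed.
Lemma linaddC : commutative linadd.
Proof. by move=> f g; apply: linear_ext => x /=; rewrite addrC. Qed.
Lemma linadd0 : left_id lin0 linadd.
Proof. by move=> f; apply: linear_ext => x /=; rewrite add0r. Qed.
Lemma linaddN : left_inverse lin0 linopp linadd.
Proof. by move=> f; apply: linear_ext => x /=; rewrite addNr. Qed.
HB.instance Definition _ :=
  GRing.isZmodule.Build {linear U -> V} linaddA linaddC linadd0 linaddN.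

Lemma lin_addE f g x : (f + g) x = f x + g x.
Proof. by []. Qed.
End LinearZmod.

Definition lin_id (R : pzRingType) (U : lmodType R) : {linear U -> U} := idfun.
Definition lin_comp (R : pzRingType) (U V W : lmodType R)
  (g : {linear V -> W}) (f : {linear U -> V}) : {linear U -> W} := g \o f.

(* There is an exact sequence R^m -> R^n -> F -> 0 of right R-modules. *)
Definition finitely_presented (R : pzRingType) (F : lmodType R^c) : Prop :=
  exists (m n : nat) (g : {linear 'rV[R^c]_m -> 'rV[R^c]_n})
         (p : {linear 'rV[R^c]_n -> F}),
    (forall x, exists v, p v = x) /\
    (forall v, p v = 0 <-> exists w, v = g w).

Record fpmod (R : pzRingType) := FPMod {
  fp_lmod :> lmodType R^c;
  fp_fp : finitely_presented fp_lmod
}.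

Section FPCategory.
Variable R : pzRingType.
Implicit Types F G H K : fpmod R.

Lemma lin_comp1m F G (f : {linear F -> G}) : lin_comp (lin_id G) f = f.
Proof. exact: linear_ext. Qed.
Lemma lin_compm1 F G (f : {linear F -> G}) : lin_comp f (lin_id F) = f.
Proof. exact: linear_ext. Qed.
Lemma lin_compA F G H K (h : {linear H -> K}) (g : {linear G -> H})
    (f : {linear F -> G}) :
  lin_comp h (lin_comp g f) = lin_comp (lin_comp h g) f.
Proof. exact: linear_ext. Qed.
Lemma lin_compDl F G H (g g' : {linear G -> H}) (f : {linear F -> G}) :
  lin_comp (g + g') f = lin_comp g f + lin_comp g' f.
Proof. exact: linear_ext. Qed.
Lemma lin_compDr F G H (g : {linear G -> H}) (f f' : {linear F -> G}) :
  lin_comp g (f + f') = lin_comp g f + lin_comp g f'.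
Proof. by apply: linear_ext => x /=; rewrite raddfD. Qed.

Definition modfp : preadd :=
  @Preadd (fpmod R) (fun F G => {linear F -> G} : zmodType)
    (fun F => lin_id F) (fun F G H g f => lin_comp g f)
    lin_comp1m lin_compm1 lin_compA lin_compDl lin_compDr.
End FPCategory.

Section BaseChange.
Variables (R S : pzRingType) (phi : {rmorphism R -> S}) (F : lmodType R^c).

Inductive bc_rel : seq (F * S) -> seq (F * S) -> Prop :=
| bc_Dl x x' s : bc_rel [:: (x + x', s)] [:: (x, s); (x', s)]
| bc_Dr x s s' : bc_rel [:: (x, s + s')] [:: (x, s); (x, s')]
| bc_0 s : bc_rel [:: (0, s)] [::]
| bc_bal x (r : R) s : bc_rel [:: ((r : R^c) *: x, s)] [:: (x, phi r * s)].

Definition bc_eq : seq (F * S) -> seq (F * S) -> Prop := sum_congr bc_rel.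
Definition bc_eqb (u v : seq (F * S)) : bool := `[< bc_eq u v >].

Lemma bc_eqb_refl : reflexive bc_eqb.
Proof. by move=> u; apply/asboolP; exact: sc_refl. Qed.
Lemma bc_eqb_sym : symmetric bc_eqb.
Proof.
by move=> u v; apply/idP/idP => /asboolP h; apply/asboolP; exact: sc_sym.
Qed.
Lemma bc_eqb_trans : transitive bc_eqb.
Proof.
by move=> v u w /asboolP h /asboolP k; apply/asboolP; exact: (sc_trans h k).
Qed.
Canonical bc_equiv := EquivRel bc_eqb bc_eqb_refl bc_eqb_sym bc_eqb_trans.

(* The right S-module F (x)_R S, for a right R-module F. *)
Definition base_change := {eq_quot bc_equiv}.
HB.instance Definition _ := Choice.on base_change.
HB.instance Definition _ := EqQuotient.on base_change.

Definition bc_cl (u : seq (F * S)) : base_change := \pi_base_change u.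

Lemma bc_clP u v : bc_cl u = bc_cl v <-> bc_eq u v.
Proof.
rewrite /bc_cl; split=> [/eqmodP/asboolP//|h].
by apply/eqmodP/asboolP.
Qed.

Lemma bc_clW (P : base_change -> Prop) :
  (forall u, P (bc_cl u)) -> forall x, P x.
Proof. by move=> h x; rewrite -[x]reprK; exact: h. Qed.

Lemma bc_repr u : bc_eq (repr (bc_cl u)) u.
Proof. by apply/bc_clP; rewrite /bc_cl reprK. Qed.

Definition bc_zero : base_change := bc_cl [::].
Definition bc_add (x y : base_change) : base_change := bc_cl (repr x ++ repr y).
Definition bc_opp (x : base_change) : base_change :=
  bc_cl [seq (- g.1, g.2) | g <- repr x].
Definition bc_scale (t : S^c) (x : base_change) : base_change :=
  bc_cl [seq (g.1, g.2 * (t : S)) | g <- repr x].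

Lemma bc_addE u v : bc_add (bc_cl u) (bc_cl v) = bc_cl (u ++ v).
Proof. by apply/bc_clP; apply: sc_cat; exact: bc_repr. Qed.

Lemma bc_oppE u : bc_opp (bc_cl u) = bc_cl [seq (- g.1, g.2) | g <- u].
Proof.
apply/bc_clP; move: (repr _) (bc_repr u) => w; elim => {u w}.
- move=> u v [x x' s|x s s'|s|x r s] /=; apply: sc_base; rewrite ?opprD ?oppr0.
  + exact: bc_Dl.
  + exact: bc_Dr.
  + exact: bc_0.
  + by rewrite -scalerN; exact: bc_bal.
- by move=> u; exact: sc_refl.
- by move=> u v _; exact: sc_sym.
- by move=> u v w _ + _; exact: sc_trans.
- by move=> u u' v v' _ iu _ iv; rewrite !map_cat; exact: sc_cat.
- by move=> u v; rewrite !map_cat; exact: sc_comm.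
Qed.

Lemma bc_scaleE t u :
  bc_scale t (bc_cl u) = bc_cl [seq (g.1, g.2 * (t : S)) | g <- u].
Proof.
apply/bc_clP; move: (repr _) (bc_repr u) => w; elim => {u w}.
- move=> u v [x x' s|x s s'|s|x r s] /=; apply: sc_base.
  + exact: bc_Dl.
  + by rewrite mulrDl; exact: bc_Dr.
  + exact: bc_0.
  + by rewrite -mulrA; exact: bc_bal.
- by move=> u; exact: sc_refl.
- by move=> u v _; exact: sc_sym.
- by move=> u v w _ + _; exact: sc_trans.
- by move=> u u' v v' _ iu _ iv; rewrite !map_cat; exact: sc_cat.
- by move=> u v; rewrite !map_cat; exact: sc_comm.
Qed.

Lemma bc_addA : associative bc_add.
Proof.
by do 3![elim/bc_clW => ?]; rewrite !bc_addE catA.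
Qed.
Lemma bc_addC : commutative bc_add.
Proof.
do 2![elim/bc_clW => ?]; rewrite !bc_addE; apply/bc_clP; exact: sc_comm.
Qed.
Lemma bc_add0 : left_id bc_zero bc_add.
Proof. by elim/bc_clW => u; rewrite bc_addE. Qed.
Lemma bc_addN : left_inverse bc_zero bc_opp bc_add.
Proof.
elim/bc_clW => u; rewrite bc_oppE bc_addE; apply/bc_clP.
elim: u => [|[x s] u iu] /=; first exact: sc_refl.
set w := map _ u in iu *.
apply: (@sc_trans _ _ _ ([:: (- x, s); (x, s)] ++ (w ++ u))); last first.
  rewrite -[[::]]/([::] ++ [::]); apply: sc_cat iu.
  apply: sc_trans (sc_base (bc_0 s)); rewrite -(addNr x).
  exact/sc_sym/sc_base/bc_Dl.
rewrite -[X in sum_congr _ X _]/([:: (- x, s)] ++ (w ++ ([:: (x, s)] ++ u))).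
rewrite -[X in sum_congr _ _ X]/([:: (- x, s)] ++ (([:: (x, s)] ++ w) ++ u)).
apply: sc_cat (sc_refl _ _) _; rewrite catA.
exact: sc_cat (sc_comm _ _ _) (sc_refl _ _).
Qed.
HB.instance Definition _ :=
  GRing.isZmodule.Build base_change bc_addA bc_addC bc_add0 bc_addN.

Lemma bc_clD u v : bc_cl (u ++ v) = bc_cl u + bc_cl v.
Proof. by rewrite -bc_addE. Qed.

Lemma bc_scaleA r s x : bc_scale r (bc_scale s x) = bc_scale (r * s) x.
Proof.
elim/bc_clW: x => u; rewrite !bc_scaleE -map_comp.
by congr bc_cl; apply: eq_map => g /=; rewrite -mulrA.
Qed.
Lemma bc_scale1 : left_id 1 bc_scale.
Proof.
elim/bc_clW => u; rewrite bc_scaleE; congr bc_cl.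
by rewrite -[RHS]map_id; apply: eq_map => -[x s] /=; rewrite mulr1.
Qed.
Lemma bc_scaleDr : right_distributive bc_scale +%R.
Proof.
move=> t; do 2![elim/bc_clW => ?].
by rewrite -bc_clD !bc_scaleE map_cat bc_clD.
Qed.
Lemma bc_scaleDl x : {morph bc_scale^~ x : s t / s + t}.
Proof.
move=> s t; elim/bc_clW: x => u; rewrite !bc_scaleE.
elim: u => [|[x r] u iu] /=; first by rewrite addr0.
rewrite -cat1s bc_clD iu -[X in _ = bc_cl X + _]cat1s -[X in _ = _ + bc_cl X]cat1s.
rewrite !bc_clD addrACA; congr (_ + _).
by rewrite -bc_clD; apply/bc_clP/sc_base; rewrite mulrDr; exact: bc_Dr.
Qed.
HB.instance Definition _ :=
  GRing.Zmodule_isLmodule.Build S^c base_change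
    bc_scaleA bc_scale1 bc_scaleDr bc_scaleDl.

Definition bc_tens (x : F) (s : S) : base_change := bc_cl [:: (x, s)].

Definition balanced (T : zmodType) (b : F -> S -> T) : Prop :=
  [/\ forall x x' s, b (x + x') s = b x s + b x' s,
      forall x s s', b x (s + s') = b x s + b x s' &
      forall x (r : R) s, b ((r : R^c) *: x) s = b x (phi r * s)].

Lemma bc_tens_balanced : balanced bc_tens.
Proof.
split=> *; rewrite /bc_tens -?bc_clD; apply/bc_clP/sc_base.
- exact: bc_Dl.
- exact: bc_Dr.
- exact: bc_bal.
Qed.

Lemma bc_tens_scale x s t : bc_tens x (s * t) = (t : S^c) *: bc_tens x s.
Proof. by rewrite /bc_tens [RHS]bc_scaleE. Qed.

Lemma bc_ind (P : base_change -> Prop) :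
  P 0 -> (forall x s, P (bc_tens x s)) -> (forall u v, P u -> P v -> P (u + v)) ->
  forall u, P u.
Proof.
move=> P0 Pt PD; elim/bc_clW; elim=> [|[x s] u iu] //.
by rewrite -cat1s bc_clD; exact: PD (Pt x s) iu.
Qed.

(* The additive map on F (x)_R S induced by a balanced map. *)
Definition bc_lift (T : zmodType) (b : F -> S -> T) (u : base_change) : T :=
  \sum_(g <- repr u) b g.1 g.2.

Section Lift.
Variables (T : zmodType) (b : F -> S -> T).
Hypothesis hb : balanced b.

Lemma bc_lift_cl u : bc_lift b (bc_cl u) = \sum_(g <- u) b g.1 g.2.
Proof.
have [bDl bDr bb] := hb.
have b0 s : b 0 s = 0 by apply: (addrI (b 0 s)); rewrite -bDl !addr0.
rewrite /bc_lift; move: (repr _) (bc_repr u) => w; elim => {u w} //.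
- move=> u v [x x' s|x s s'|s|x r s] /=; rewrite !big_cons !big_nil /= ?addr0.
  + exact: bDl.
  + exact: bDr.
  + exact: b0.
  + exact: bb.
- by move=> u v w _ -> _ ->.
- by move=> u u' v v' _ iu _ iv; rewrite !big_cat; congr (_ + _).
- by move=> u v; rewrite !big_cat /= addrC.
Qed.

Lemma bc_liftE x s : bc_lift b (bc_tens x s) = b x s.
Proof. by rewrite bc_lift_cl big_seq1. Qed.

Lemma bc_liftD u v : bc_lift b (u + v) = bc_lift b u + bc_lift b v.
Proof.
elim/bc_clW: u => u; elim/bc_clW: v => v.
by rewrite -bc_clD !bc_lift_cl big_cat.
Qed.

Lemma bc_lift0 : bc_lift b 0 = 0.
Proof. by apply: (addrI (bc_lift b 0)); rewrite -bc_liftD !addr0. Qed.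
End Lift.

Section LinearLift.
Variables (T : lmodType S^c) (b : F -> S -> T) (hb : balanced b).
Hypothesis hS : forall x s t, b x (s * t) = (t : S^c) *: b x s.

Definition bc_lin_fun of balanced b
  & (forall x s t, b x (s * t) = (t : S^c) *: b x s) := bc_lift b.

Lemma bc_lin_linear : linear (bc_lin_fun hb hS).
Proof.
move=> t u v; rewrite /bc_lin_fun bc_liftD //; congr (_ + _).
elim/bc_ind: u => [|x s|u w iu iw].
- by rewrite scaler0 !bc_lift0 // scaler0.
- by rewrite -bc_tens_scale !bc_liftE.
- by rewrite scalerDr !bc_liftD // iu iw scalerDr.
Qed.
HB.instance Definition _ :=
  GRing.isLinear.Build S^c base_change T *:%R (bc_lin_fun hb hS) bc_lin_linear.
Definition bc_lin : {linear base_change -> T} := bc_lin_fun hb hS.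

Lemma bc_linE x s : bc_lin (bc_tens x s) = b x s.
Proof. exact: bc_liftE. Qed.
End LinearLift.

Lemma bc_linear_ext (T : lmodType S^c) (f g : {linear base_change -> T}) :
  (forall x s, f (bc_tens x s) = g (bc_tens x s)) -> f = g.
Proof.
move=> fg; apply: linear_ext; elim/bc_ind => [|//|u v iu iv].
  by rewrite !linear0.
by rewrite !linearD iu iv.
Qed.

End BaseChange.

Section BaseChangeMap.
Variables (R S : pzRingType) (phi : {rmorphism R -> S}).
Implicit Types F G H : lmodType R^c.

Section Map.
Variables (F G : lmodType R^c) (f : {linear F -> G}).
Let b (x : F) (s : S) := bc_tens phi (f x) s.
Lemma bc_map_balanced : balanced phi b.
Proof.
have [bDl bDr bb] := bc_tens_balanced phi G.
rewrite /b; split=> [x x' s|x s s'|x r s].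
- by rewrite linearD bDl.
- exact: bDr.
- by rewrite linearZ bb.
Qed.
Lemma bc_map_scale x s t : b x (s * t) = (t : S^c) *: b x s.
Proof. exact: bc_tens_scale. Qed.
Definition bc_map : {linear base_change phi F -> base_change phi G} :=
  bc_lin bc_map_balanced bc_map_scale.
Lemma bc_mapE x s : bc_map (bc_tens phi x s) = bc_tens phi (f x) s.
Proof. exact: bc_linE. Qed.
End Map.

Lemma bc_map_id F : bc_map (lin_id F) = lin_id (base_change phi F).
Proof. by apply: bc_linear_ext => x s; rewrite bc_mapE. Qed.

Lemma bc_map_comp F G H (g : {linear G -> H}) (f : {linear F -> G}) :
  bc_map (lin_comp g f) = lin_comp (bc_map g) (bc_map f).
Proof.
apply: bc_linear_ext => x s.
by rewrite bc_mapE -[RHS]/(bc_map g (bc_map f (bc_tens phi x s))) !bc_mapE.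
Qed.

Lemma bc_map_additive F G : zmod_morphism (@bc_map F G).
Proof.
have [bDl _ _] := bc_tens_balanced phi G.
move=> f g; apply/eqP; rewrite eq_sym subr_eq; apply/eqP.
apply: bc_linear_ext => x s.
by rewrite lin_addE !bc_mapE -bDl -lin_addE subrK.
Qed.
HB.instance Definition _ F G :=
  GRing.isZmodMorphism.Build {linear F -> G}
    {linear base_change phi F -> base_change phi G} (@bc_map F G)
    (@bc_map_additive F G).

Section FinitePresentation.
Variable F : lmodType R^c.

Let Phi n (v : 'rV[R^c]_n) : 'rV[S^c]_n := \row_i (phi (v 0 i) : S^c).
Lemma PhiB n (v w : 'rV[R^c]_n) : Phi (v - w) = Phi v - Phi w.
Proof. by apply/rowP => i; rewrite !mxE raddfB. Qed.
Lemma PhiZ n (r : R^c) (v : 'rV[R^c]_n) : Phi (r *: v) = (phi r : S^c) *: Phi v.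
Proof. by apply/rowP => i; rewrite !mxE; exact: (rmorphM phi (v 0 i : R) (r : R)). Qed.
Lemma Phi_delta n i : Phi (delta_mx 0 i : 'rV[R^c]_n) = delta_mx 0 i.
Proof.
apply/rowP => j; rewrite !mxE.
by case: (_ && _); [exact: (rmorph1 phi)|exact: (rmorph0 phi)].
Qed.

Section Comb.
Variables (T : pzRingType) (V : lmodType T) (n : nat) (e : 'I_n -> V).
Definition comb (v : 'rV[T]_n) : V := \sum_i v 0 i *: e i.
Lemma comb_linear : linear comb.
Proof.
move=> t v w; rewrite /comb scaler_sumr -big_split; apply: eq_bigr => i _ /=.
by rewrite !mxE scalerDl scalerA.
Qed.
HB.instance Definition _ := GRing.isLinear.Build T _ V *:%R comb comb_linear.
Lemma comb_delta i : comb (delta_mx 0 i) = e i.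
Proof.
rewrite /comb (bigD1 i) //= mxE !eqxx scale1r big1 ?addr0 // => j ji.
by rewrite mxE eqxx (negPf ji) scale0r.
Qed.
End Comb.

Lemma lin_comb (T : pzRingType) (V : lmodType T) (n : nat)
  (g : {linear 'rV[T]_n -> V}) v : g v = comb (fun i => g (delta_mx 0 i)) v.
Proof.
rewrite {1}(row_sum_delta v) linear_sum; apply: eq_bigr => i _.
by rewrite linearZ.
Qed.

Lemma bc_fp : finitely_presented F -> finitely_presented (base_change phi F).
Proof.
have [tDl tDr tb] := bc_tens_balanced phi F.
case=> m [n [g [p [psurj pker]]]].
have [p' p'E] : exists p' : {linear 'rV[S^c]_n -> base_change phi F},
  p' =1 comb (fun i => bc_tens phi (p (delta_mx 0 i)) 1) by eexists.
have [g' g'E] : exists g' : {linear 'rV[S^c]_m -> 'rV[S^c]_n},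
  g' =1 comb (fun j => Phi (g (delta_mx 0 j))) by eexists.
have t0 s : bc_tens phi (0 : F) s = 0.
  by apply: (addrI (bc_tens phi 0 s)); rewrite -tDl !addr0.
have tsum (I : finType) (x : I -> F) s :
    bc_tens phi (\sum_i x i) s = \sum_i bc_tens phi (x i) s.
  exact: (big_morph (fun x => bc_tens phi x s) (fun x y => tDl x y s) (t0 s)).
have p'Phi v : p' (Phi v) = bc_tens phi (p v) 1.
  rewrite (lin_comb p) p'E /comb tsum; apply: eq_bigr => i _.
  by rewrite mxE tb -bc_tens_scale mul1r mulr1.
have g'Phi w : g' (Phi w) = Phi (g w).
  rewrite (lin_comb g) g'E /comb.
  have PhiD : {morph (@Phi n) : v w / v + w}.
    by move=> v w0; apply/rowP => i; rewrite !mxE raddfD.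
  rewrite (big_morph (@Phi n) PhiD (id1 := 0)); last first.
    by apply/rowP => i; rewrite !mxE raddf0.
  by apply: eq_bigr => i _; rewrite mxE PhiZ.
have Phiker v : p v = 0 -> exists w, Phi v = g' w.
  by case/pker => w ->; exists (Phi w); rewrite g'Phi.
exists m, n, g', p'; split.
  apply: bc_ind.
  - by exists 0; rewrite linear0.
  - move=> x s; have [v <-] := psurj x; exists ((s : S^c) *: Phi v).
    by rewrite linearZ /= p'Phi -bc_tens_scale mul1r.
  - by move=> u v [u' <-] [v' <-]; exists (u' + v'); rewrite linearD.
move=> v; split; last first.
  case=> w ->; rewrite (lin_comb g') /comb linear_sum big1 // => j _.
  rewrite linearZ /= g'E comb_delta p'Phi.
  have -> : p (g (delta_mx 0 j)) = 0 by apply/pker; exists (delta_mx 0 j).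
  by rewrite t0 scaler0.
have [l lP] : exists l : F -> 'rV[R^c]_n, forall x, p (l x) = x.
  by exists (fun x => sval (cid (psurj x))) => x; case: cid.
pose L (u : seq (F * S)) : 'rV[S^c]_n := \sum_(h <- u) (h.2 : S^c) *: Phi (l h.1).
have LP u w : bc_eq phi u w -> exists z, L u - L w = g' z.
  elim=> {u w}.
  - have key s x : p x = 0 -> exists z, (s : S^c) *: Phi x = g' z.
      by case/Phiker => z ->; exists ((s : S^c) *: z); rewrite linearZ.
    move=> u w [x x' s|x s s'|s|x r s]; rewrite /L !big_cons !big_nil /= ?addr0.
    + rewrite -scalerDr -scalerBr opprD addrA -!PhiB; apply: key.
      by rewrite !linearB /= !lP addrAC addrK subrr.
    + exists 0; rewrite linear0; apply/eqP; rewrite subr_eq0; apply/eqP.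
      exact: (scalerDl (_ : 'rV[S^c]_n) (s : S^c) (s' : S^c)).
    + by rewrite subr0; apply: key; rewrite lP.
    + have -> : (phi r * s : S^c) *: Phi (l x) = (s : S^c) *: Phi ((r : R^c) *: l x).
        by rewrite PhiZ scalerA.
      by rewrite -scalerBr -PhiB; apply: key; rewrite linearB linearZ /= !lP subrr.
  - by move=> u; exists 0; rewrite linear0 subrr.
  - by move=> u w _ [z zE]; exists (- z); rewrite linearN -zE opprB.
  - move=> u w y _ [z zE] _ [z' zE']; exists (z + z').
    by rewrite linearD -zE -zE' addrA subrK.
  - move=> u u' w w' _ [z zE] _ [z' zE']; exists (z + z').
    by rewrite /L !big_cat /= linearD -zE -zE' opprD addrACA.
  - by move=> u w; exists 0; rewrite linear0 /L !big_cat /= [X in X - _]addrC subrr.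
move=> p'v0.
pose u := [seq (p (delta_mx 0 i), v 0 i : S) | i <- index_enum 'I_n].
have /LP[z zE] : bc_eq phi u [::].
  apply/bc_clP; rewrite -[RHS]p'v0 p'E /comb /u.
  elim: (index_enum _) => [|i s is_] /=; first by rewrite big_nil.
  rewrite big_cons -is_ -cat1s bc_clD; congr (_ + _).
  by rewrite -bc_tens_scale mul1r.
have LE : L u = \sum_i v 0 i *: Phi (l (p (delta_mx 0 i))) by rewrite /L big_map.
have L0 : L [::] = 0 by rewrite /L big_nil.
have [z' z'E] : exists z', \sum_i v 0 i *: Phi (l (p (delta_mx 0 i))) - v = g' z'.
  have kk i : exists w, Phi (l (p (delta_mx 0 i)) - delta_mx 0 i) = g' w.
    by apply: Phiker; rewrite linearB lP subrr.
  exists (\sum_i v 0 i *: sval (cid (kk i))).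
  rewrite linear_sum [X in _ - X](row_sum_delta v) -sumrB; apply: eq_bigr => i _.
  by case: cid => w /= wE; rewrite [RHS]linearZ /= -wE PhiB Phi_delta scalerBr.
exists (z - z').
by rewrite linearB -zE -z'E L0 LE subr0 opprB addrCA subrr addr0.
Qed.
End FinitePresentation.
End BaseChangeMap.

Section BaseChangeFunctor.
Variables (R S : pzRingType) (phi : {rmorphism R -> S}).

Definition bc_fpmod (F : fpmod R) : fpmod S := FPMod (bc_fp phi (fp_fp F)).

(* - (x)_R S : mod-R -> mod-S *)
Definition bc_functor : add_functor (modfp R) (modfp S) :=
  @AddFunctor (modfp R) (modfp S) bc_fpmod
    (fun F G => @bc_map R S phi F G :
       {additive {linear F -> G} ->
                 {linear base_change phi F -> base_change phi G}})
    (fun F => bc_map_id phi F) (fun F G H g f => bc_map_comp phi g f).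

End BaseChangeFunctor.

Section Delta.
Variables (R : pzRingType) (phi : {rmorphism R -> R}).
Hypothesis phiE : forall r, phi r = r.
Variable F : lmodType R^c.

Definition bc_delta_fun of (forall r, phi r = r) :=
  fun x : F => bc_tens phi x 1.
Lemma bc_delta_linear : linear (bc_delta_fun phiE).
Proof.
have [tDl _ tb] := bc_tens_balanced phi F.
move=> r x y; rewrite /bc_delta_fun tDl tb phiE; congr (_ + _).
by rewrite -bc_tens_scale mul1r mulr1.
Qed.
HB.instance Definition _ :=
  GRing.isLinear.Build R^c F (base_change phi F) *:%R (bc_delta_fun phiE)
    bc_delta_linear.
Definition bc_delta : {linear F -> base_change phi F} := bc_delta_fun phiE.

Lemma bc_deltaE x : bc_delta x = bc_tens phi x 1.
Proof. by []. Qed.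

Let act (x : F) (s : R) : F := (s : R^c) *: x.
Lemma bc_delta_act : balanced phi act.
Proof.
rewrite /act; split=> [x x' s|x s s'|x r s].
- exact: scalerDr.
- exact: (scalerDl x (s : R^c) (s' : R^c)).
- by rewrite phiE scalerA.
Qed.
Lemma bc_delta_act_scale x s t : act x (s * t) = (t : R^c) *: act x s.
Proof. by rewrite /act scalerA. Qed.
Definition bc_delta_inv : {linear base_change phi F -> F} :=
  bc_lin bc_delta_act bc_delta_act_scale.

Lemma bc_deltaK : lin_comp bc_delta_inv bc_delta = lin_id F.
Proof.
apply: linear_ext => x.
rewrite -[LHS]/(bc_delta_inv (bc_tens phi x 1)) bc_linE.
exact: scale1r.
Qed.

Lemma bc_delta_invK : lin_comp bc_delta bc_delta_inv = lin_id (base_change phi F).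
Proof.
apply: bc_linear_ext => x s.
rewrite -[LHS]/(bc_delta (bc_delta_inv (bc_tens phi x s))) bc_linE.
by rewrite linearZ /= bc_deltaE -bc_tens_scale mul1r.
Qed.
End Delta.

Section Mu.
Variables (R S T : pzRingType) (phi : {rmorphism R -> S}).
Variables (psi : {rmorphism S -> T}) (chi : {rmorphism R -> T}).
Hypothesis chiE : forall r, chi r = psi (phi r).
Variable F : lmodType R^c.

Let b2 (t : T) (x : F) (s : S) := bc_tens chi x (psi s * t).
Let b (u : base_change phi F) (t : T) := bc_lift (b2 t) u.

Lemma bc_mu_b2 t : balanced phi (b2 t).
Proof.
have [tDl tDr tb] := bc_tens_balanced chi F.
rewrite /b2; split=> [x x' s|x s s'|x r s].
- exact: tDl.
- by rewrite raddfD mulrDl tDr.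
- by rewrite tb chiE rmorphM mulrA.
Qed.

Lemma bc_mu_b2E x s t : b (bc_tens phi x s) t = bc_tens chi x (psi s * t).
Proof. exact: (bc_liftE (bc_mu_b2 t)). Qed.

Lemma bc_mu_bD u v t : b (u + v) t = b u t + b v t.
Proof. exact: (bc_liftD (bc_mu_b2 t)). Qed.

Lemma bc_mu_b0 t : b 0 t = 0.
Proof. exact: (bc_lift0 (bc_mu_b2 t)). Qed.

Lemma bc_mu_balanced : balanced psi b.
Proof.
have [_ tDr _] := bc_tens_balanced chi F.
split=> [u v t|u t t'|u s t].
- exact: bc_mu_bD.
- elim/bc_ind: u => [|x s|u v iu iv]; first by rewrite !bc_mu_b0 addr0.
    by rewrite !bc_mu_b2E mulrDr tDr.
  by rewrite !bc_mu_bD iu iv addrACA.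
- elim/bc_ind: u => [|x s'|u v iu iv]; first by rewrite scaler0 !bc_mu_b0.
    by rewrite -bc_tens_scale !bc_mu_b2E rmorphM mulrA.
  by rewrite scalerDr !bc_mu_bD iu iv.
Qed.

Lemma bc_mu_scale u t t' : b u (t * t') = (t' : T^c) *: b u t.
Proof.
elim/bc_ind: u => [|x s|u v iu iv]; first by rewrite !bc_mu_b0 scaler0.
  by rewrite !bc_mu_b2E mulrA bc_tens_scale.
by rewrite !bc_mu_bD iu iv scalerDr.
Qed.

Definition bc_mu :
    {linear base_change psi (base_change phi F) -> base_change chi F} :=
  bc_lin bc_mu_balanced bc_mu_scale.

Lemma bc_muE x s t :
  bc_mu (bc_tens psi (bc_tens phi x s) t) = bc_tens chi x (psi s * t).
Proof. by rewrite bc_linE bc_mu_b2E. Qed.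

Let c (x : F) (t : T) := bc_tens psi (bc_tens phi x 1) t.
Lemma bc_mu_inv_balanced : balanced chi c.
Proof.
have [tDl tDr tb] := bc_tens_balanced phi F.
have [tDl' tDr' tb'] := bc_tens_balanced psi (base_change phi F).
rewrite /c; split=> [x x' t|x t t'|x r t].
- by rewrite tDl tDl'.
- exact: tDr'.
- by rewrite tb mulr1 -[phi r]mul1r bc_tens_scale tb' chiE.
Qed.
Lemma bc_mu_inv_scale x t t' : c x (t * t') = (t' : T^c) *: c x t.
Proof. exact: bc_tens_scale. Qed.
Definition bc_mu_inv :
    {linear base_change chi F -> base_change psi (base_change phi F)} :=
  bc_lin bc_mu_inv_balanced bc_mu_inv_scale.

Lemma bc_mu_invE x t :
  bc_mu_inv (bc_tens chi x t) = bc_tens psi (bc_tens phi x 1) t.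
Proof. exact: bc_linE. Qed.

Lemma bc_linear_ext2 (V : lmodType T^c)
    (f g : {linear base_change psi (base_change phi F) -> V}) :
  (forall x s t, f (bc_tens psi (bc_tens phi x s) t) =
                 g (bc_tens psi (bc_tens phi x s) t)) -> f = g.
Proof.
have [tDl _ _] := bc_tens_balanced psi (base_change phi F).
move=> fg; apply: bc_linear_ext => u t.
elim/bc_ind: u => [|//|u v iu iv].
  have -> : bc_tens psi (0 : base_change phi F) t = 0.
    by apply: (addrI (bc_tens psi 0 t)); rewrite -tDl !addr0.
  by rewrite !linear0.
by rewrite tDl !linearD iu iv.
Qed.

Lemma bc_muK : lin_comp bc_mu_inv bc_mu = lin_id _.
Proof.
have [_ _ tb] := bc_tens_balanced psi (base_change phi F).
apply: bc_linear_ext2 => x s t.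
rewrite -[LHS]/(bc_mu_inv (bc_mu (bc_tens psi (bc_tens phi x s) t))).
by rewrite bc_muE bc_mu_invE -tb -bc_tens_scale mul1r.
Qed.

Lemma bc_mu_invK : lin_comp bc_mu bc_mu_inv = lin_id _.
Proof.
apply: bc_linear_ext => x t.
rewrite -[LHS]/(bc_mu (bc_mu_inv (bc_tens chi x t))).
by rewrite bc_mu_invE bc_muE rmorph1 mul1r.
Qed.
End Mu.

Lemma bc_linear_ext3 (R S T U : pzRingType) (phi : {rmorphism R -> S})
    (psi : {rmorphism S -> T}) (chi : {rmorphism T -> U}) (F : lmodType R^c)
    (V : lmodType U^c)
    (f g : {linear base_change chi (base_change psi (base_change phi F)) -> V}) :
  (forall x s t u, f (bc_tens chi (bc_tens psi (bc_tens phi x s) t) u) =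
                   g (bc_tens chi (bc_tens psi (bc_tens phi x s) t) u)) -> f = g.
Proof.
have [tDl _ _] := bc_tens_balanced psi (base_change phi F).
move=> fg; apply: bc_linear_ext2 => x t u.
have [tDl' _ _] := bc_tens_balanced chi (base_change psi (base_change phi F)).
elim/bc_ind: x => [|//|v w iv iw].
  have -> : bc_tens psi (0 : base_change phi F) t = 0.
    by apply: (addrI (bc_tens psi 0 t)); rewrite -tDl !addr0.
  have -> : bc_tens chi (0 : base_change psi (base_change phi F)) u = 0.
    by apply: (addrI (bc_tens chi 0 u)); rewrite -tDl' !addr0.
  by rewrite !linear0.
by rewrite tDl tDl' !linearD iv iw.
Qed.

Section InducedRepresentation.
Variables (C : category) (R : ring_rep C).

Let S (c : C) : preadd := modfp (R c).
Let Smap c d (al : hom c d) : add_functor (S c) (S d) := bc_functor (rr_map R al).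

Definition fp_delta c (F : S c) : {linear F -> base_change (rr_map R (idm c)) F} :=
  bc_delta (@rr_id C R c) F.
Definition fp_mu c d e (be : hom d e) (al : hom c d) (F : S c) :
    {linear base_change (rr_map R be) (base_change (rr_map R al) F) ->
            base_change (rr_map R (comp be al)) F} :=
  bc_mu (@rr_comp C R c d e be al) F.

Lemma fp_delta_iso c (F : S c) :
  @piso (S c) F (Smap (idm c) F) (@fp_delta c F).
Proof.
exists (bc_delta_inv (@rr_id C R c) F); split.
- exact: bc_deltaK.
- exact: bc_delta_invK.
Qed.

Lemma fp_mu_iso c d e (be : hom d e) (al : hom c d) (F : S c) :
  @piso (S e) (Smap be (Smap al F)) (Smap (comp be al) F) (fp_mu be al F).
Proof.
exists (bc_mu_inv (@rr_comp C R c d e be al) F); split.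
- exact: bc_muK.
- exact: bc_mu_invK.
Qed.

Lemma fp_delta_nat c (F G : S c) (f : {linear F -> G}) :
  lin_comp (fp_delta G) f = lin_comp (bc_map (rr_map R (idm c)) f) (fp_delta F).
Proof.
apply: linear_ext => x.
rewrite -[RHS]/(bc_map (rr_map R (idm c)) f (bc_tens (rr_map R (idm c)) x 1)).
by rewrite bc_mapE.
Qed.

Lemma fp_mu_nat c d e (be : hom d e) (al : hom c d) (F G : S c)
    (f : {linear F -> G}) :
  lin_comp (fp_mu be al G) (bc_map (rr_map R be) (bc_map (rr_map R al) f)) =
  lin_comp (bc_map (rr_map R (comp be al)) f) (fp_mu be al F).
Proof.
apply: bc_linear_ext2 => x s t.
rewrite -[LHS]/(fp_mu be al G (bc_map (rr_map R be) (bc_map (rr_map R al) f) _)).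
rewrite -[RHS]/(bc_map (rr_map R (comp be al)) f (fp_mu be al F _)).
by rewrite !bc_mapE !bc_muE bc_mapE.
Qed.

Lemma fp_cast c d (al be : hom c d) (e : al = be) (F : S c) x s :
  (rep_cast Smap e F :
     {linear base_change (rr_map R al) F -> base_change (rr_map R be) F})
    (bc_tens (rr_map R al) x s) = bc_tens (rr_map R be) x s.
Proof. by case: _ / e. Qed.

Lemma fp_unitl c d (al : hom c d) (F : S c) :
  @pcomp (S d) (Smap al F) (Smap (comp (idm d) al) F) (Smap al F)
    (rep_cast Smap (comp1m al) F)
    (lin_comp (fp_mu (idm d) al F) (fp_delta (Smap al F))) =
  lin_id (base_change (rr_map R al) F).
Proof.
apply: bc_linear_ext => x s.
rewrite -[LHS]/((rep_cast Smap (comp1m al) F :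
    {linear base_change (rr_map R (comp (idm d) al)) F ->
            base_change (rr_map R al) F})
  (fp_mu (idm d) al F (bc_tens _ (bc_tens _ x s) 1))).
by rewrite bc_muE fp_cast rr_id mulr1.
Qed.

Lemma fp_unitr c d (al : hom c d) (F : S c) :
  @pcomp (S d) (Smap al F) (Smap (comp al (idm c)) F) (Smap al F)
    (rep_cast Smap (compm1 al) F)
    (lin_comp (fp_mu al (idm c) F) (bc_map (rr_map R al) (fp_delta F))) =
  lin_id (base_change (rr_map R al) F).
Proof.
apply: bc_linear_ext => x s.
rewrite -[LHS]/((rep_cast Smap (compm1 al) F :
    {linear base_change (rr_map R (comp al (idm c))) F ->
            base_change (rr_map R al) F})
  (fp_mu al (idm c) F (bc_map (rr_map R al) (fp_delta F) (bc_tens _ x s)))).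
by rewrite bc_mapE bc_muE fp_cast rmorph1 mul1r.
Qed.

Lemma fp_assoc c d e f (ga : hom e f) (be : hom d e) (al : hom c d) (F : S c) :
  @pcomp (S f) (Smap ga (Smap be (Smap al F))) (Smap (comp ga (comp be al)) F)
    (Smap (comp (comp ga be) al) F) (rep_cast Smap (compA ga be al) F)
    (lin_comp (fp_mu ga (comp be al) F) (bc_map (rr_map R ga) (fp_mu be al F))) =
  lin_comp (fp_mu (comp ga be) al F) (fp_mu ga be (Smap al F)).
Proof.
apply: bc_linear_ext3 => x s s' t.
rewrite -[LHS]/((rep_cast Smap (compA ga be al) F :
    {linear base_change (rr_map R (comp ga (comp be al))) F ->
            base_change (rr_map R (comp (comp ga be) al)) F})
  (fp_mu ga (comp be al) F (bc_map (rr_map R ga) (fp_mu be al F)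
    (bc_tens _ (bc_tens _ (bc_tens _ x s) s') t)))).
rewrite -[RHS]/(fp_mu (comp ga be) al F (fp_mu ga be (Smap al F)
    (bc_tens _ (bc_tens _ (bc_tens _ x s) s') t))).
by rewrite bc_mapE !bc_muE fp_cast rmorphM rr_comp mulrA.
Qed.

Definition fp_representation : representation C :=
  @Representation C S Smap fp_delta fp_mu fp_delta_iso fp_mu_iso
    fp_delta_nat fp_mu_nat fp_unitl fp_unitr fp_assoc.

End InducedRepresentation.

Section YonedaModule.
Variables (R : pzRingType) (M : rmod (ringcat R)).

Section Act.
Variables (F G : modfp R) (h : {linear F -> G}).
Definition yon_act (f : {linear G -> rmod_lmod M}) : {linear F -> rmod_lmod M} :=
  lin_comp f h.
Lemma yon_act_additive : zmod_morphism yon_act.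
Proof.
move=> f g; apply/eqP; rewrite eq_sym subr_eq; apply/eqP.
apply: linear_ext => x.
by rewrite lin_addE -[LHS]/(f (h x)) -[in LHS](subrK g f).
Qed.
HB.instance Definition _ :=
  GRing.isZmodMorphism.Build {linear G -> rmod_lmod M} {linear F -> rmod_lmod M}
    yon_act yon_act_additive.
End Act.

Lemma yon_actD (F G : modfp R) (h k : {linear F -> G}) f :
  yon_act (h + k) f = yon_act h f + yon_act k f.
Proof.
apply: linear_ext => x.
by rewrite lin_addE -[LHS]/(f ((h + k) x)) lin_addE linearD.
Qed.
Lemma yon_act1 (F : modfp R) f : yon_act (lin_id F) f = f.
Proof. exact: linear_ext. Qed.
Lemma yon_actM (F G H : modfp R) (h : {linear G -> H}) (k : {linear F -> G}) f :
  yon_act (lin_comp h k) f = yon_act k (yon_act h f).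
Proof. exact: linear_ext. Qed.

(* Hom_R(-, M) restricted to finitely presented modules. *)
Definition yoneda_rmod : rmod (modfp R) :=
  @RMod (modfp R) (fun F => {linear F -> rmod_lmod M} : zmodType)
    (fun F G h => @yon_act F G h) yon_actD yon_act1 yon_actM.
End YonedaModule.

Section RHomLinear.
Variables (R : pzRingType) (M N : rmod (ringcat R)) (f : rhom M N).
Definition rhom_fun (x : rmod_lmod M) : rmod_lmod N := f tt x.
Lemma rhom_linear : linear rhom_fun.
Proof.
move=> r x y; rewrite /rhom_fun raddfD; congr (_ + _).
exact: (rhnat f (r : @phom (ringcat R) tt tt) x).
Qed.
HB.instance Definition _ :=
  GRing.isLinear.Build R^c (rmod_lmod M) (rmod_lmod N) *:%R rhom_fun rhom_linear.
Definition rhom_lin : {linear rmod_lmod M -> rmod_lmod N} := rhom_fun.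
End RHomLinear.

(* Hom_R(-, f) restricted to finitely presented modules. *)
Section YonedaMap.
Variables (R : pzRingType) (M N : rmod (ringcat R)) (f : rhom M N).
Section At.
Variable F : modfp R.
Definition yon_map (h : {linear F -> rmod_lmod M}) : {linear F -> rmod_lmod N} :=
  lin_comp (rhom_lin f) h.
Lemma yon_map_additive : zmod_morphism yon_map.
Proof.
move=> h k; apply/eqP; rewrite eq_sym subr_eq; apply/eqP; apply: linear_ext => x.
rewrite lin_addE -[LHS]/(rhom_lin f (h x)) -[in LHS](subrK k h) lin_addE.
exact: linearD.
Qed.
HB.instance Definition _ :=
  GRing.isZmodMorphism.Build {linear F -> rmod_lmod M} {linear F -> rmod_lmod N}
    yon_map yon_map_additive.
End At.
Lemma yon_map_nat (F G : modfp R) (h : {linear F -> G}) k :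
  yon_map (yon_act h k) = yon_act h (yon_map k).
Proof. exact: linear_ext. Qed.
Definition yoneda_rhom : rhom (yoneda_rmod M) (yoneda_rmod N) :=
  @RHom (modfp R) (yoneda_rmod M) (yoneda_rmod N) (fun F => @yon_map F) yon_map_nat.
End YonedaMap.

Section YonedaAdjoint.
Variables (R S : pzRingType) (phi : {rmorphism R -> S}).
Variables (M : rmod (ringcat R)) (N : rmod (ringcat S)).
Variable m : rhom M (pull (ringfun phi) N).

Section At.
Variable F : lmodType R^c.

Section Adj.
Variable f : {linear F -> rmod_lmod M}.
Let b (x : F) (s : S) : rmod_lmod N := (s : S^c) *: (m tt (f x) : rmod_lmod N).
Lemma yon_adj_balanced : balanced phi b.
Proof.
rewrite /b; split=> [x x' s|x s s'|x r s].
- by rewrite linearD raddfD; exact: scalerDr.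
- exact: scalerDl.
- rewrite linearZ.
  have -> : (m tt ((r : R^c) *: f x : rmod_lmod M) : rmod_lmod N) =
            (phi r : S^c) *: (m tt (f x) : rmod_lmod N).
    exact: (rhnat m (r : @phom (ringcat R) tt tt) (f x)).
  by rewrite scalerA.
Qed.
Lemma yon_adj_scale x s t : b x (s * t) = (t : S^c) *: b x s.
Proof. by rewrite /b scalerA. Qed.
(* The map F (x)_R S -> N adjoint to the composite F -> M -> phi^* N. *)
Definition yon_adj : {linear base_change phi F -> rmod_lmod N} :=
  bc_lin yon_adj_balanced yon_adj_scale.
Lemma yon_adjE x s :
  yon_adj (bc_tens phi x s) = (s : S^c) *: (m tt (f x) : rmod_lmod N).
Proof. exact: bc_linE. Qed.
End Adj.

Lemma yon_adj_additive : zmod_morphism yon_adj.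
Proof.
move=> h k; apply/eqP; rewrite eq_sym subr_eq; apply/eqP.
apply: bc_linear_ext => x s.
rewrite lin_addE !yon_adjE -scalerDr -[in LHS](subrK k h) lin_addE; congr (_ *: _).
exact: raddfD.
Qed.
HB.instance Definition _ :=
  GRing.isZmodMorphism.Build {linear F -> rmod_lmod M}
    {linear base_change phi F -> rmod_lmod N} yon_adj yon_adj_additive.
End At.

Lemma yon_adj_nat (F G : modfp R) (h : {linear F -> G}) f :
  yon_adj (yon_act h f) =
  yon_act (F := bc_fpmod phi F) (G := bc_fpmod phi G) (bc_map phi h) (yon_adj f).
Proof.
apply: bc_linear_ext => x s.
rewrite -[RHS]/(yon_adj f (bc_map phi h (bc_tens phi x s))).
by rewrite bc_mapE !yon_adjE.
Qed.

Definition yoneda_adj :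
    rhom (yoneda_rmod M) (pull (bc_functor phi) (yoneda_rmod N)) :=
  @RHom (modfp R) (yoneda_rmod M) (pull (bc_functor phi) (yoneda_rmod N))
    (fun F => @yon_adj (F : fpmod R)) yon_adj_nat.
End YonedaAdjoint.

Section Yoneda.
Variables (C : category) (R : ring_rep C).
Notation Rrep := (ring_representation R).
Notation Rfp := (fp_representation R).

Section Object.
Variable M : smod Rrep.
Let YM c : rmod (Rfp c) := yoneda_rmod (M c).
Let Ymap c d (al : hom c d) : rhom (YM c) (pull (rep_map Rfp al) (YM d)) :=
  yoneda_adj (smmap M al).

Lemma yoneda_mu c d e (be : hom d e) (al : hom c d) (F : Rfp c)
    (f : {linear (F : modfp (R c)) -> rmod_lmod (M c)}) :
  Ymap be (rep_map Rfp al F) (Ymap al F f) =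
  ract (YM e) (rep_mu Rfp be al F) (Ymap (comp be al) F f).
Proof.
apply: bc_linear_ext2 => x s t.
rewrite -[LHS]/(yon_adj (smmap M be) (yon_adj (smmap M al) f) _).
rewrite -[RHS]/(yon_adj (smmap M (comp be al)) f (fp_mu be al F _)).
rewrite bc_muE !yon_adjE.
have -> : smmap M be tt ((s : (R d)^c) *: (smmap M al tt (f x) : rmod_lmod (M d))) =
   (rr_map R be s : (R e)^c) *: (smmap M be tt (smmap M al tt (f x)) : rmod_lmod (M e)).
  exact: (rhnat (smmap M be) (s : @phom (ringcat (R d)) tt tt) _).
have -> : smmap M be tt (smmap M al tt (f x)) = smmap M (comp be al) tt (f x).
  by rewrite (@sm_mu C Rrep M c d e be al tt (f x)) (ract1 (r := M e)).
by rewrite scalerA.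
Qed.

Lemma yoneda_delta c (F : Rfp c)
    (f : {linear (F : modfp (R c)) -> rmod_lmod (M c)}) :
  ract (YM c) (rep_delta Rfp F) (Ymap (idm c) F f) = f.
Proof.
apply: linear_ext => x.
rewrite -[LHS]/(yon_adj (smmap M (idm c)) f (bc_tens _ x 1)) yon_adjE scale1r.
by rewrite -[RHS](@sm_delta C Rrep M c tt (f x)) (ract1 (r := M c)).
Qed.

Definition yoneda_obj : smod Rfp :=
  @SMod C Rfp YM Ymap yoneda_mu yoneda_delta.
End Object.

Section Morphism.
Variables (M N : smod Rrep) (phi : shom M N).
Lemma yoneda_shom_nat c d (al : hom c d) (F : Rfp c)
    (f : {linear (F : modfp (R c)) -> rmod_lmod (M c)}) :
  smmap (yoneda_obj N) al F (yoneda_rhom (phi c) F f) =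
  yoneda_rhom (phi d) (rep_map Rfp al F) (smmap (yoneda_obj M) al F f).
Proof.
apply: bc_linear_ext => x s.
rewrite -[LHS]/(yon_adj (smmap N al) (yon_map (phi c) f) _).
rewrite -[RHS]/(rhom_lin (phi d) (yon_adj (smmap M al) f _)).
rewrite !yon_adjE linearZ; congr (_ *: _).
exact: (@shnat C Rrep M N phi c d al tt (f x)).
Qed.
Definition yoneda_shom : shom (yoneda_obj M) (yoneda_obj N) :=
  @SHom C Rfp (yoneda_obj M) (yoneda_obj N) (fun c => yoneda_rhom (phi c))
    yoneda_shom_nat.
End Morphism.

Lemma yoneda_id (M : smod Rrep) : yoneda_shom (shom_id M) = shom_id (yoneda_obj M).
Proof. by apply: shom_ext => c F f; apply: linear_ext. Qed.

Lemma yoneda_comp (M N P : smod Rrep) (g : shom N P) (f : shom M N) :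
  yoneda_shom (shom_comp g f) = shom_comp (yoneda_shom g) (yoneda_shom f).
Proof. by apply: shom_ext => c F h; apply: linear_ext. Qed.

Definition Yoneda : functor (Mod Rrep) (Mod Rfp) :=
  @Functor (Mod Rrep) (Mod Rfp) yoneda_obj yoneda_shom yoneda_id yoneda_comp.
End Yoneda.

(* Main.v *)
From HB Require Import structures.
From mathcomp Require Import all_boot all_algebra.
From mathcomp Require Import boolp.
Require Import Defs.

(** Over a ring [R], the flat right modules over the category of finitely
    presented modules are exactly the functors [Hom_R(-, X)].  The theorem is this
    fact in families, together with a comparison of the two cartesian conditions.

    [Hom_R(-, X)] is flat because its category of elements is filtered
    ([yoneda_filtered]): sums and cokernels of finitely presented modules are
    finitely presented.  For a functor with filtered category of elements each
    tensor is a single [x (x) y], and two such tensors agree only if they do so at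
    some later stage ([teq_cofactors]); exactness of the tensor product follows
    ([filtered_flat]).  Conversely, a flat functor [N] takes cokernels to kernels,
    as one sees by tensoring it with a left exact sequence of representable
    functors ([flat_ract_inj], [flat_ract_ker]).  Applied to a presentation
    [R^m -> R^n -> F -> 0] this yields [N F = Hom_R(F, N R)] ([values_bij]).

    In families, a locally flat [N] over [R_fp] is therefore isomorphic to the
    image of the module with components [N_c(R_c)] ([yoneda_esurj]), and a
    morphism between Yoneda modules is determined by what it does at the regular
    modules, where it is a morphism of the original modules ([yoneda_full],
    [yoneda_faithful]).  This is the first equivalence.

    For the second one it remains to see that [M] is cartesian if and only if
    [Y(M)] is ([yoneda_adj_is_iso]).  For a ring map [R -> S], the adjoint of the
    structure map of [Y(M)] at [b] is
    [Hom_R(-, M_c) (x) Hom_S(b, - (x)_R S) -> Hom_S(b, M_d)].  At [b = S] it is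
    the adjoint [M_c (x)_R S -> M_d] of the structure map of [M]
    ([bijective_at_reg]).  By filteredness the left-hand side is a filtered
    colimit of the groups [Hom_S(b, F (x)_R S)] over the maps [F -> M_c], and as
    [b] is finitely presented, bijectivity at [S] implies bijectivity at [b]
    ([bijective_at_fp]). *)

Set Implicit Arguments.
Unset Strict Implicit.
Unset Printing Implicit Defensive.

Import GRing.Theory.
Local Open Scope ring_scope.
Local Open Scope quotient_scope.

(** * Fully faithful, essentially surjective functors *)

Section Equivalence.
Variables (C D : category) (F : functor C D).
Hypothesis F_full : forall a b (g : hom (F a) (F b)), exists f, fmap F f = g.
Hypothesis F_faithful :
  forall a b (f f' : hom a b), fmap F f = fmap F f' -> f = f'.
Hypothesis F_esurj : forall d, exists (a : C) (e : hom (F a) d), is_iso e.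

(** Chosen preimages of the objects of [D] form a quasi-inverse; a morphism of
    [D] is conjugated by the chosen isomorphisms and lifted along [F]. *)
Lemma fully_faithful_esurj_equivalence : is_equivalence F.
Proof.
pose G0 d := sval (cid (F_esurj d)).
have esE d : exists e : hom (F (G0 d)) d, is_iso e.
  by rewrite /G0; case: cid.
pose e d := sval (cid (esE d)).
have eiso d : is_iso (e d) by rewrite /e; case: cid.
pose e' d := sval (cid (eiso d)).
have e'K d : comp (e' d) (e d) = idm (F (G0 d)).
  by rewrite /e'; case: cid => g [].
have eK d : comp (e d) (e' d) = idm d.
  by rewrite /e'; case: cid => g [].
pose lift a b (g : hom (F a) (F b)) := sval (cid (F_full g)).
have liftK a b (g : hom (F a) (F b)) : fmap F (lift a b g) = g.
  by rewrite /lift; case: cid.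
pose G1 d d' (f : hom d d') := lift _ _ (comp (e' d') (comp f (e d))).
have G1_id d : G1 d d (idm d) = idm (G0 d).
  by apply: F_faithful; rewrite liftK comp1m e'K fmap1.
have G1_comp d d' d'' (g : hom d' d'') (f : hom d d') :
    G1 d d'' (comp g f) = comp (G1 d' d'' g) (G1 d d' f).
  apply: F_faithful; rewrite fmapM !liftK.
  by rewrite -!compA; congr comp; congr comp; rewrite compA eK comp1m.
exists (Functor G1_id G1_comp); split.
- exists (fun a => lift (G0 (F a)) a (e (F a))); split.
    move=> a b f; apply: F_faithful; rewrite !fmapM /= !liftK.
    by rewrite compA eK comp1m.
  move=> a; exists (lift a (G0 (F a)) (e' (F a))); split; apply: F_faithful.
    by rewrite fmapM !liftK e'K fmap1.
  by rewrite fmapM !liftK eK fmap1.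
- exists e; split=> [d d' f|//].
  by rewrite /= liftK compA eK comp1m.
Qed.
End Equivalence.

(** * Flatness from a filtered category of elements *)

Section Tensor.
Variables (A : preadd) (H : rmod A).

Lemma tgenr0 (N : lmod A) (a : A) (x : H a) : teq [:: tgen (N := N) x 0] [::].
Proof.
have -> : (0 : N a) = lact N (0 : phom a a) 0 by rewrite raddf0.
apply: sc_trans (sc_sym (sc_base (trel_bal _ _ _))) _.
have -> : ract H (0 : phom a a) x = 0.
  by apply: (addrI (ract H (0 : phom a a) x)); rewrite -ractD !addr0.
exact: sc_base (trel_0 _ _).
Qed.

(** The category of pairs [(a, x)] with [x] in [H a] is filtered.  Parallel maps
    are equalized by annihilating their difference, which additivity of [H]
    makes equivalent to the usual condition. *)
Definition filtered_elements : Prop :=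
  [/\ inhabited A,
    forall a b (x : H a) (y : H b),
      exists c (f : phom a c) (g : phom b c) (z : H c),
        ract H f z = x /\ ract H g z = y &
    forall a b (f : phom a b) (x : H b), ract H f x = 0 ->
      exists c (g : phom b c) (z : H c), ract H g z = x /\ pcomp g f = 0].

Hypothesis Hfilt : filtered_elements.
Let directed := let: And3 _ h _ := Hfilt in h.
Let annihilated := let: And3 _ _ h := Hfilt in h.

Section Realization.
Variable N : lmod A.

(** A common stage for a tensor sum: every first component of [u] is a
    restriction of the single element [x], and pushing the second components to
    [a] and adding them up yields [s], so that [u] equals [x (x) s]. *)
Fixpoint factors (a : A) (x : H a) (u : tsum H N) (s : N a) : Prop :=
  if u is g :: u' then
    exists (f : phom (tag g) a) (t : N a),
      [/\ ract H f x = (tagged g).1, s = lact N f (tagged g).2 + t & factors x u' t]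
  else s = 0.

Lemma factors_cons a (x : H a) b (f : phom b a) (x' : H b) (y : N b) u s :
  ract H f x = x' -> factors x u s -> factors x (tgen x' y :: u) (lact N f y + s).
Proof. by move=> fx us; exists f, s. Qed.

Lemma factors_teq a (x : H a) u s : factors x u s -> teq u [:: tgen x s].
Proof.
elim: u s => [s ->|[b [x' y]] u iu s]; first exact/sc_sym/tgenr0.
case=> f [t [/= <- -> /iu ut]].
rewrite -cat1s; apply: sc_trans (sc_sym (sc_base (trel_Dr _ _ _))).
by rewrite -[X in sum_congr _ _ X]cat1s; apply: sc_cat ut; apply/sc_base/trel_bal.
Qed.

Lemma factors_map a b (f : phom a b) (x : H a) (z : H b) u s :
  ract H f z = x -> factors x u s -> factors z u (lact N f s).
Proof.
move=> fz; elim: u s => [s ->|[c [x' y]] u iu s]; first by rewrite raddf0.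
case=> g [t [/= gx -> /iu ut]]; rewrite raddfD -lactM.
by apply: factors_cons ut; rewrite ractM fz.
Qed.

Lemma factors_cat a (x : H a) u v s t :
  factors x u s -> factors x v t -> factors x (u ++ v) (s + t).
Proof.
elim: u s => [s ->|[b [x' y]] u iu s]; first by rewrite add0r.
case=> g [s' [/= gx -> us]] vt; rewrite -addrA.
exact: factors_cons (iu _ us vt).
Qed.

Lemma factors_catP a (x : H a) u v s :
  factors x (u ++ v) s ->
  exists s1 s2, [/\ s = s1 + s2, factors x u s1 & factors x v s2].
Proof.
elim: u s => [|[b [x' y]] u iu] s; first by exists 0, s; rewrite add0r.
case=> f [t [/= fx -> /iu[s1 [s2 [-> us vs]]]]].
by exists (lact N f y + s1), s2; rewrite addrA; split=> //; exists f, s1.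
Qed.

Lemma factors_exists u : exists a (x : H a) s, factors x u s.
Proof.
elim: u => [|[b [x' y]] u [a [x [s us]]]].
  by have [[a] _ _] := Hfilt; exists a, 0, 0.
have [c [f [g [z [zx' zx]]]]] := directed x' x.
exists c, z, (lact N f y + lact N g s).
by by apply: factors_cons zx' _; exact: factors_map us.
Qed.

Lemma equalized a b (f g : phom a b) (x : H b) : ract H f x = ract H g x ->
  exists c (h : phom b c) (z : H c),
    ract H h z = x /\ forall y, lact N h (lact N f y) = lact N h (lact N g y).
Proof.
move=> fg; have : ract H (f - g) x = 0.
  have := @ractD A H _ _ (f - g) g x; rewrite subrK fg.
  by rewrite -[LHS]add0r => /addIr <-.
case/annihilated=> c [h [z [hz hfg]]]; exists c, h, z; split=> // y.
rewrite -!lactM; congr (lact N _ y).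
by have := pcompDr h (f - g) g; rewrite subrK hfg add0r.
Qed.

(** Two factorizations through the same [x] differ by pairs of maps with the same
    effect on [x]; equalizing these one after the other identifies the sums. *)
Lemma factors_unique a (x : H a) u s t : factors x u s -> factors x u t ->
  exists b (f : phom a b) (z : H b), ract H f z = x /\ lact N f s = lact N f t.
Proof.
elim: u s t => [|[b [x' y]] u iu] s t.
  by move=> -> ->; exists a, (pid a), x; rewrite ract1.
case=> f [s' [/= fx -> us]] [g [t' [/= gx -> ut]]].
have [c [h [z [hz hst]]]] := iu _ _ us ut.
have [|d [k [w [kw kfg]]]] := @equalized _ _ (pcomp h f) (pcomp h g) z.
  by rewrite !ractM hz fx gx.
exists d, (pcomp k h), w; rewrite ractM kw; split=> //.
rewrite !lactM !raddfD /= hst.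
by rewrite -[lact N h (lact N f y)]lactM -[lact N h (lact N g y)]lactM kfg.
Qed.

(** Equality at a common stage.  It is shown below to contain the congruence
    [teq], which turns the inductively generated equality of tensors into a
    concrete witness. *)
Definition cofactors (u v : tsum H N) : Prop :=
  exists a (x : H a) s, factors x u s /\ factors x v s.

Lemma cofactors_refl u : cofactors u u.
Proof. by have [a [x [s us]]] := factors_exists u; exists a, x, s. Qed.

Lemma cofactorsI a (x : H a) u v s t :
  factors x u s -> factors x v t ->
  (exists b (f : phom a b) (z : H b), ract H f z = x /\ lact N f s = lact N f t) ->
  cofactors u v.
Proof.
move=> us vt [b [f [z [fz fst]]]]; exists b, z, (lact N f s).
by split; [|rewrite fst]; apply: factors_map fz _.
Qed.

Lemma directed_factors u v : exists a (x : H a) s t, factors x u s /\ factors x v t.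
Proof.
have [a [x [s us]]] := factors_exists (u ++ v).
have [s1 [s2 [_ ? ?]]] := factors_catP us.
by exists a, x, s1, s2.
Qed.

(** [cofactors] contains the generators and is a congruence; the only delicate
    closure property is transitivity, where the middle term is factored in two
    ways and [factors_unique] reconciles them. *)
Lemma teq_cofactors u v : teq u v -> cofactors u v.
Proof.
elim=> {u v}.
- move=> u v [a x x' y|a x y y'|a y|a b f x y].
  + have [b [z [s [_ [[f [_ [/= fz _ [f' [_ [/= fz' _ _]]]]]] _]]]]] :=
      directed_factors [:: tgen x y; tgen x' y] [::].
    exists b, z, (lact N f y + (lact N f' y + 0)); split; last first.
      by do 2!apply: factors_cons => //.
    rewrite addr0 -lactD -[lact N _ y]addr0.
    by apply: factors_cons; rewrite // ractD fz fz'.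
  + exists a, x, (lact N (pid a) (y + y') + 0); split.
      by apply: factors_cons; rewrite // ract1.
    by rewrite raddfD -addrA; do 2!(apply: factors_cons; first by rewrite ract1).
  + exists a, 0, 0; split=> //=; exists 0, 0; rewrite addr0 raddf0; split=> //.
    by apply: (addrI (lact N (0 : phom a a) y)); rewrite -lactD !addr0.
  + exists b, x, (lact N (pid b) (lact N f y) + 0); split; last first.
      by apply: factors_cons; rewrite // ract1.
    by rewrite lact1; exact: factors_cons.
- exact: cofactors_refl.
- by move=> u v _ [a [x [s [us vs]]]]; exists a, x, s.
- move=> u v w _ [a [x [s [us vs]]]] _ [b [y [t [vt wt]]]].
  have [c [f [g [z [fz gz]]]]] := directed x y.
  apply: (cofactorsI (factors_map fz us) (factors_map gz wt)).
  exact: factors_unique (factors_map fz vs) (factors_map gz vt).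
- move=> u u' v v' _ [a [x [s [us us']]]] _ [b [y [t [vt vt']]]].
  have [c [f [g [z [fz gz]]]]] := directed x y.
  exists c, z, (lact N f s + lact N g t).
  by split; apply: factors_cat; (exact: factors_map fz _ || exact: factors_map gz _).
- move=> u v; have [a [x [s [t [us vt]]]]] := directed_factors u v.
  exists a, x, (s + t); split; first exact: factors_cat.
  by rewrite addrC; exact: factors_cat.
Qed.

(** A filtered colimit identifies two elements of the same stage only if they
    already agree at a later stage. *)
Lemma tgen_teq a (x : H a) y y' : teq [:: tgen (N := N) x y] [:: tgen x y'] ->
  exists b (f : phom a b) (z : H b), ract H f z = x /\ lact N f y = lact N f y'.
Proof.
case/teq_cofactors=> b [z [s [[f [t [/= fz -> ->]]] [g [t' [/= gz e t'0]]]]]].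
rewrite t'0 !addr0 in e.
have [|c [h [w [hw hfg]]]] := @equalized _ _ f g z; first by rewrite fz gz.
by exists c, (pcomp h f), w; rewrite ractM hw; split; rewrite // !lactM e hfg.
Qed.

End Realization.

Lemma factors_tmapP (N N' : lmod A) (f : lhom N N') u a (x : H a) s :
  factors x (tmap f u) s -> exists2 t, factors x u t & s = f a t.
Proof.
elim: u s => [|[b [x' y]] u iu] s; first by move=> ->; exists 0; rewrite ?raddf0.
case=> g [s' [/= gx -> /iu[t ut ->]]].
exists (lact N g y + t); first exact: factors_cons.
by rewrite raddfD lhnat.
Qed.

(** Over a common stage [a] a tensor is a single [x (x) s] with [s] in the value of
    the left module at [a], so that exactness of the tensored sequence is read
    off from exactness at [a]. *)
Lemma filtered_flat : flat H.
Proof.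
move=> N1 N2 N3 f g ex; split.
- move=> u v /teq_cofactors[a [x [s [/factors_tmapP[t ut ->] /factors_tmapP[t' vt']]]]].
  have [finj _ _] := ex a => /finj tt'.
  apply: sc_trans (factors_teq ut) _; rewrite tt'; exact/sc_sym/factors_teq.
- move=> v; split.
    move=> /teq_cofactors[a [x [s [/factors_tmapP[t vt ->] gt0]]]].
    have [_ fg _] := ex a.
    have /fg[y ty] : g a t = 0 := gt0.
    exists [:: tgen x y]; apply: sc_trans (factors_teq vt) _.
    by rewrite ty; exact: sc_refl.
  case=> u /(tmap_teq g) vu; apply: (sc_trans vu).
  elim: u {vu} => [|[b [x y]] u iu]; first exact: sc_refl.
  rewrite /tmap /= -cat1s -[[::]]/([::] ++ [::]); apply: sc_cat iu.
  have [_ fg _] := ex b.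
  have -> : g b (f b y) = 0 by apply/fg; exists y.
  exact: tgenr0.
- elim=> [|[b [x y]] w [v vw]]; first by exists [::]; exact: sc_refl.
  have [_ _ gsurj] := ex b; have [z gz] := gsurj y.
  exists (tgen x z :: v); rewrite /tmap /= -cat1s -[X in teq _ X]cat1s.
  by apply: sc_cat vw; rewrite gz; exact: sc_refl.
Qed.

End Tensor.

(** * Cokernels of abelian groups and of left modules *)

Section Cokernel.
Variables (U V : zmodType) (f : {additive U -> V}).

Definition in_image : {pred V} := fun y => `[< exists x, y = f x >].
Lemma in_image_zmod_closed : zmod_closed in_image.
Proof.
split; first by apply/asboolP; exists 0; rewrite raddf0.
move=> _ _ /asboolP[x ->] /asboolP[y ->].
by apply/asboolP; exists (x - y); rewrite raddfB.
Qed.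
HB.instance Definition _ := GRing.isZmodClosed.Build V in_image in_image_zmod_closed.

Definition coker : zmodType := Quotient.quot in_image.
Definition coker_pi : {additive V -> coker} := \pi_(Quotient.quot in_image).

Lemma coker_pi_eq0 y : coker_pi y = 0 <-> exists x, y = f x.
Proof.
rewrite -[0](raddf0 coker_pi); split.
  by move/eqP; rewrite -Quotient.idealrBE subr0 => /asboolP.
by move=> im; apply/eqP; rewrite -Quotient.idealrBE subr0; apply/asboolP.
Qed.

Lemma coker_pi_surj q : exists y, coker_pi y = q.
Proof. by exists (repr q); exact: reprK. Qed.

Section Lift.
Variables (W : zmodType) (h : {additive V -> W}).
Hypothesis hf0 : forall x, h (f x) = 0.
Definition coker_lift_fun of (forall x, h (f x) = 0) := fun q : coker => h (repr q).
Lemma coker_lift_pi y : coker_lift_fun hf0 (coker_pi y) = h y.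
Proof.
rewrite /coker_lift_fun; apply/eqP; rewrite -subr_eq0 -raddfB.
have /coker_pi_eq0[x ->] : coker_pi (repr (coker_pi y) - y) = 0.
  by rewrite raddfB /= [X in X - _]reprK subrr.
by rewrite hf0.
Qed.
Lemma coker_lift_additive : zmod_morphism (coker_lift_fun hf0).
Proof.
move=> p q; have [x <-] := coker_pi_surj p; have [y <-] := coker_pi_surj q.
by rewrite -raddfB !coker_lift_pi raddfB.
Qed.
HB.instance Definition _ :=
  GRing.isZmodMorphism.Build coker W (coker_lift_fun hf0) coker_lift_additive.
Definition coker_lift : {additive coker -> W} := coker_lift_fun hf0.
Lemma coker_liftE y : coker_lift (coker_pi y) = h y.
Proof. exact: coker_lift_pi. Qed.
End Lift.
End Cokernel.

Section LmodCokernel.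
Variables (A : preadd) (N1 N2 : lmod A) (j : lhom N1 N2).

Section Act.
Variables (a b : A) (f : phom a b).
Let h : {additive N2 a -> coker (j b)} := (coker_pi (j b) \o lact N2 f : N2 a -> _).
Lemma lcoker_act_subproof x : h (j a x) = 0.
Proof. by rewrite /h /= -lhnat; apply/coker_pi_eq0; exists (lact N1 f x). Qed.
Definition lcoker_act : {additive coker (j a) -> coker (j b)} :=
  coker_lift lcoker_act_subproof.
Lemma lcoker_actE x : lcoker_act (coker_pi (j a) x) = coker_pi (j b) (lact N2 f x).
Proof. exact: coker_liftE. Qed.
End Act.

Lemma lcoker_actD a b (f g : phom a b) x :
  lcoker_act (f + g) x = lcoker_act f x + lcoker_act g x.
Proof. by have [y <-] := coker_pi_surj x; rewrite !lcoker_actE lactD raddfD. Qed.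
Lemma lcoker_act1 a x : lcoker_act (pid a) x = x.
Proof. by have [y <-] := coker_pi_surj x; rewrite !lcoker_actE lact1. Qed.
Lemma lcoker_actM a b c (g : phom b c) (f : phom a b) x :
  lcoker_act (pcomp g f) x = lcoker_act g (lcoker_act f x).
Proof. by have [y <-] := coker_pi_surj x; rewrite !lcoker_actE lactM. Qed.

Definition lcoker : lmod A :=
  @LMod A (fun a => coker (j a)) lcoker_act lcoker_actD lcoker_act1 lcoker_actM.

Definition lcoker_pi : lhom N2 lcoker :=
  @LHom A N2 lcoker (fun a => coker_pi (j a))
    (fun a b f x => esym (lcoker_actE f x)).

Lemma lcoker_short_exact : (forall a, injective (j a)) -> short_exact j lcoker_pi.
Proof.
by move=> jinj a; split=> //; [exact: coker_pi_eq0|exact: coker_pi_surj].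
Qed.

Section Lift.
Variables (N3 : lmod A) (k : lhom N2 N3).
Hypothesis kj0 : forall a x, k a (j a x) = 0.
Lemma lcoker_lift_nat a b (f : phom a b) (x : lcoker a) :
  coker_lift (@kj0 b) (lact lcoker f x) = lact N3 f (coker_lift (@kj0 a) x).
Proof.
have [y <-] := coker_pi_surj x.
by rewrite lcoker_actE !coker_liftE lhnat.
Qed.
Definition lcoker_lift : lhom lcoker N3 :=
  @LHom A lcoker N3 (fun a => coker_lift (@kj0 a)) lcoker_lift_nat.
End Lift.
End LmodCokernel.

(** * Flat functors are left exact *)

Section LeftExact.
Variable A : preadd.

Definition id_add_functor : add_functor A A :=
  @AddFunctor A A id (fun _ _ => idfun) (fun _ => erefl) (fun _ _ _ _ _ => erefl).

Definition repr_lmod (a : A) : lmod A := corep id_add_functor a.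

Section Precomp.
Variables (a b : A) (f : phom a b).
Definition precomp c (h : phom b c) : phom a c := pcomp h f.
Lemma precomp_additive c : zmod_morphism (@precomp c).
Proof.
by move=> h k; rewrite /precomp; apply/eqP; rewrite eq_sym subr_eq -pcompDl subrK.
Qed.
HB.instance Definition _ c :=
  GRing.isZmodMorphism.Build _ _ (@precomp c) (@precomp_additive c).
Lemma precomp_nat c d (k : phom c d) (h : phom b c) :
  precomp (pcomp k h) = pcomp k (precomp h).
Proof. by rewrite /precomp pcompA. Qed.
Definition repr_lhom : lhom (repr_lmod b) (repr_lmod a) :=
  @LHom A (repr_lmod b) (repr_lmod a) (fun c => @precomp c)
    (fun c d k h => precomp_nat k h).
End Precomp.

Variable M : rmod A.

Definition repr_rhom : rhom M (pull id_add_functor M) :=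
  @RHom A M (pull id_add_functor M) (fun a => idfun) (fun _ _ _ _ => erefl).

Lemma ract0 a b x : ract M (0 : phom a b) x = 0.
Proof. by apply: (addrI (ract M (0 : phom a b) x)); rewrite -ractD !addr0. Qed.

Definition tensor_eval a : tsum M (repr_lmod a) -> M a :=
  @adjoint _ _ _ _ _ repr_rhom a.

(** The Yoneda isomorphism [M (x)_A Hom(a, -) = M a]: by balancedness
    [x (x) h = (x . h) (x) id]. *)
Lemma tensor_evalK a (u : tsum M (repr_lmod a)) :
  teq u [:: tgen (N := repr_lmod a) (tensor_eval u) (pid a)].
Proof.
elim: u => [|[b [x h]] u iu].
  rewrite /tensor_eval /adjoint big_nil; exact/sc_sym/sc_base/trel_0.
rewrite /tensor_eval /adjoint big_cons /=.
apply: sc_trans (sc_sym (sc_base (trel_Dl _ _ _))).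
rewrite -[X in sum_congr _ X _]cat1s -[X in sum_congr _ _ X]cat1s.
apply: sc_cat iu.
rewrite -{1}[h](pcompm1 h).
exact/sc_sym/sc_base/(trel_bal (N := repr_lmod a) h x (pid a)).
Qed.

Lemma tensor_eval1 a x : tensor_eval [:: tgen (N := repr_lmod a) x (pid a)] = x.
Proof. by rewrite /tensor_eval /adjoint big_seq1 /= ract1. Qed.

Lemma tensor_eval_teq a (u v : tsum M (repr_lmod a)) :
  teq u v -> tensor_eval u = tensor_eval v.
Proof. exact: adjoint_teq. Qed.

Lemma tensor_eval_precomp a b (f : phom a b) (u : tsum M (repr_lmod b)) :
  tensor_eval (tmap (repr_lhom f) u) = ract M f (tensor_eval u).
Proof.
rewrite /tensor_eval /adjoint big_map raddf_sum; apply: eq_bigr => -[c [x h]] _ /=.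
by rewrite -ractM.
Qed.

Variables (a1 a2 a3 : A) (g : phom a1 a2) (p : phom a2 a3).
Hypothesis Mflat : flat M.
(** The hypotheses say that [p] is a cokernel of [g].  They make
    [0 -> Hom(a3, -) -> Hom(a2, -) -> Hom(a1, -)] exact.  As flatness speaks of
    short exact sequences, this one is cut into two, the middle term being the
    cokernel [Q] of the first map. *)
Hypothesis pg0 : pcomp p g = 0.
Hypothesis p_epi : forall b (k : phom a3 b), pcomp k p = 0 -> k = 0.
Hypothesis p_factor : forall b (h : phom a2 b),
  pcomp h g = 0 -> exists k : phom a3 b, h = pcomp k p.

Let j := repr_lhom p.
Let j_inj a : injective (j a).
Proof. exact/raddf_inj/p_epi. Qed.

Let ex1 : short_exact j (lcoker_pi j) := lcoker_short_exact j_inj.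

Let i0 a x : repr_lhom g a (j a x) = 0.
Proof.
rewrite /= /precomp -pcompA pg0.
by apply: (addrI (pcomp x 0)); rewrite -pcompDr !addr0.
Qed.
Let i := lcoker_lift i0.
Let i_inj a : injective (i a).
Proof.
apply: raddf_inj => q; have [h <-] := coker_pi_surj q.
rewrite coker_liftE => /p_factor[k ->].
by apply/coker_pi_eq0; exists k.
Qed.
Let ex2 : short_exact i (lcoker_pi i) := lcoker_short_exact i_inj.

(** [M (x) Hom(a3, -) -> M (x) Hom(a2, -)] is injective, and by the Yoneda
    isomorphism it is the action of [p]. *)
Lemma flat_ract_inj : injective (ract M p).
Proof.
move=> x x' e; have [jinj _ _] := Mflat ex1.
rewrite -[x]tensor_eval1 -[x']tensor_eval1; apply/tensor_eval_teq/jinj.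
apply: sc_trans (tensor_evalK _) (sc_trans _ (sc_sym (tensor_evalK _))).
by rewrite !tensor_eval_precomp !tensor_eval1 e; exact: sc_refl.
Qed.

(** If [x] is killed by [g] then [x (x) id] vanishes in [M (x) Hom(a1, -)], hence
    already in [M (x) Q] because [Q] embeds in [Hom(a1, -)]; exactness of the
    first sequence then makes it come from [M (x) Hom(a3, -)]. *)
Lemma flat_ract_ker x : ract M g x = 0 -> exists y, x = ract M p y.
Proof.
move=> gx0; have [iinj _ _] := Mflat ex2; have [_ jex _] := Mflat ex1.
pose u : tsum M (repr_lmod a2) := [:: tgen (N := repr_lmod a2) x (pid a2)].
have /jex[v uv] : teq (tmap (lcoker_pi j) u) [::].
  apply: iinj; rewrite -[tmap i [::]]/[::].
  have -> : tmap i (tmap (lcoker_pi j) u) = tmap (repr_lhom g) u.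
    rewrite /tmap -map_comp; apply: eq_map => -[c [y h]].
    exact: (congr1 (tgen (N := repr_lmod a1) y) (coker_liftE (@i0 c) h)).
  apply: sc_trans (tensor_evalK _) _.
  rewrite tensor_eval_precomp tensor_eval1 gx0; exact: sc_base (trel_0 _ _).
exists (tensor_eval v).
by rewrite -tensor_eval_precomp -(tensor_eval_teq uv) tensor_eval1.
Qed.
End LeftExact.

(** * Linear maps and finitely presented modules *)

Section LinearMaps.
Variable R : pzRingType.

Lemma lin_sumE (I : finType) (U V : lmodType R) (f : I -> {linear U -> V}) u :
  (\sum_i f i) u = \sum_i f i u.
Proof. by elim/big_rec2: _ => [//|i v h _ <-]; rewrite lin_addE. Qed.

Lemma linear_of (U V : lmodType R) (f : U -> V) :
  linear f -> exists F : {linear U -> V}, F =1 f.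
Proof.
move=> fl; pose m := GRing.isLinear.Build R U V *:%R f fl.
by pose F : {linear U -> V} := HB.pack f m; exists F.
Qed.

Lemma linear_factor (U V W : lmodType R) (p : {linear U -> V}) (h : {linear U -> W}) :
  (forall v, exists u, p u = v) -> (forall u, p u = 0 -> h u = 0) ->
  exists k : {linear V -> W}, forall u, k (p u) = h u.
Proof.
move=> psurj hp0; pose s v := sval (cid (psurj v)).
have ps v : p (s v) = v by rewrite /s; case: cid.
have hs u u' : p u = p u' -> h u = h u'.
  move=> e; apply/eqP; rewrite -subr_eq0 -linearB; apply/eqP/hp0.
  by rewrite linearB e subrr.
have [k kE] : exists k : {linear V -> W}, k =1 h \o s.
  apply: linear_of => r x y /=; rewrite -linearP; apply: hs.
  by rewrite linearP !ps.
by exists k => u; rewrite kE /=; apply: hs; rewrite ps.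
Qed.

Lemma row_linear (V : lmodType R) n (e : 'I_n -> V) :
  exists f : {linear 'rV[R]_n -> V}, forall i, f (delta_mx 0 i) = e i.
Proof.
by have [f fE] := linear_of (comb_linear e); exists f => i; rewrite fE comb_delta.
Qed.

Lemma row_linear_ext (V : lmodType R) n (f g : {linear 'rV[R]_n -> V}) :
  (forall i, f (delta_mx 0 i) = g (delta_mx 0 i)) -> f =1 g.
Proof.
move=> fg v; rewrite (lin_comb f) (lin_comb g) /comb.
by apply: eq_bigr => i _; rewrite fg.
Qed.

(** Free modules of finite rank are projective. *)
Lemma row_lift (V W : lmodType R) n (p : {linear W -> V}) (h : {linear 'rV[R]_n -> V}) :
  (forall v, exists u, p u = v) ->
  exists k : {linear 'rV[R]_n -> W}, forall u, p (k u) = h u.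
Proof.
move=> psurj.
have [k kE] := row_linear (fun i => sval (cid (psurj (h (delta_mx 0 i))))).
by exists k; apply: (@row_linear_ext _ _ (p \o k)) => i /=; rewrite kE; case: cid.
Qed.

Section LinCokernel.
Variables (U V : lmodType R) (f : {linear U -> V}).
Definition lin_coker := Quotient.quot (in_image f).
HB.instance Definition _ := GRing.Zmodule.on lin_coker.
Definition lin_coker_scale (r : R) (q : lin_coker) : lin_coker :=
  coker_pi f (r *: (repr q : V)).
Lemma lin_coker_scaleE r v : lin_coker_scale r (coker_pi f v) = coker_pi f (r *: v).
Proof.
rewrite /lin_coker_scale; apply/eqP; rewrite -subr_eq0 -raddfB -scalerBr.
have /coker_pi_eq0[u ->] : coker_pi f (repr (coker_pi f v) - v) = 0.
  by rewrite raddfB /= [X in X - _]reprK subrr.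
by apply/eqP/coker_pi_eq0; exists (r *: u); rewrite -[LHS](linearZZ f).
Qed.
Lemma lin_coker_scaleA r s q :
  lin_coker_scale r (lin_coker_scale s q) = lin_coker_scale (r * s) q.
Proof. by have [v <-] := coker_pi_surj q; rewrite !lin_coker_scaleE scalerA. Qed.
Lemma lin_coker_scale1 : left_id 1 lin_coker_scale.
Proof.
by move=> q; have [v <-] := coker_pi_surj q; rewrite lin_coker_scaleE scale1r.
Qed.
Lemma lin_coker_scaleDr : right_distributive lin_coker_scale +%R.
Proof.
move=> r q q'; have [v <-] := coker_pi_surj q; have [v' <-] := coker_pi_surj q'.
by rewrite -raddfD !lin_coker_scaleE scalerDr raddfD.
Qed.
Lemma lin_coker_scaleDl q : {morph lin_coker_scale^~ q : r s / r + s}.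
Proof.
move=> r s; have [v <-] := coker_pi_surj q.
by rewrite !lin_coker_scaleE scalerDl raddfD.
Qed.
HB.instance Definition _ :=
  GRing.Zmodule_isLmodule.Build R lin_coker lin_coker_scaleA lin_coker_scale1
    lin_coker_scaleDr lin_coker_scaleDl.
Lemma linear_cokernel : exists p : {linear V -> lin_coker},
  (forall q, exists v, p v = q) /\ (forall v, p v = 0 <-> exists u, v = f u).
Proof.
have [|p pE] := @linear_of V lin_coker (coker_pi f).
  by move=> r x y; rewrite raddfD -lin_coker_scaleE.
exists p; split=> [q|v]; last by rewrite pE; exact: coker_pi_eq0.
by have [v <-] := coker_pi_surj q; exists v.
Qed.
End LinCokernel.

(** An element of a module is a linear map out of the regular module; this is
    how the elements of [M] will be seen inside [Hom(-, M)]. *)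
Definition hat_fun (V : lmodType R) (x : V) (r : R^o) : V := (r : R) *: x.
Lemma hat_linear (V : lmodType R) (x : V) : linear (hat_fun x).
Proof. by move=> r s t; rewrite /hat_fun scalerDl scalerA. Qed.
HB.instance Definition _ (V : lmodType R) (x : V) :=
  GRing.isLinear.Build R R^o V *:%R (hat_fun x) (hat_linear x).
Definition hat (V : lmodType R) (x : V) : {linear R^o -> V} := hat_fun x.

Lemma hatE (V : lmodType R) (x : V) r : hat x r = (r : R) *: x.
Proof. by []. Qed.
Lemma hat1 (V : lmodType R) (x : V) : hat x 1 = x.
Proof. exact: scale1r. Qed.
Lemma hat_eta (V : lmodType R) (f : {linear R^o -> V}) : f = hat (f 1).
Proof. by apply: linear_ext => r; rewrite hatE -linearZ /= [r *: _]mulr1. Qed.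
Lemma comp_hat (V W : lmodType R) (f : {linear V -> W}) x :
  lin_comp f (hat x) = hat (f x).
Proof. by apply: linear_ext => r; rewrite /lin_comp /= [LHS]linearZ. Qed.
Lemma hatD (V : lmodType R) (x y : V) : hat (x + y) = hat x + hat y.
Proof. by apply: linear_ext => r; rewrite lin_addE !hatE scalerDr. Qed.
End LinearMaps.

Section FinitelyPresented.
Variable R : pzRingType.

Lemma row_fp n : finitely_presented 'rV[R^c]_n.
Proof.
exists 0, n, \0, idfun; split=> [x|v]; first by exists x.
by split=> /= [->|[w ->]] //; exists 0.
Qed.
Definition row_fpmod n : fpmod R := FPMod (row_fp n).

Lemma reg_fp : finitely_presented (R^c)^o.
Proof.
have [p pE] := row_linear (fun _ : 'I_1 => 1 : (R^c)^o).
have pv v : p v = v 0 0.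
  by rewrite (lin_comb p) /comb big_ord1 pE [LHS]mulr1.
exists 0, 1, \0, p; split=> [x|v].
  by exists (const_mx x); rewrite pv mxE.
split=> [|[w ->]]; last by rewrite linear0.
by rewrite pv => v0; exists 0; apply/rowP => i; rewrite ord1 v0 mxE.
Qed.
Definition reg_fpmod : fpmod R := FPMod reg_fp.

Lemma prod_fp (F G : lmodType R^c) :
  finitely_presented F -> finitely_presented G -> finitely_presented (F * G)%type.
Proof.
case=> m1 [n1 [g1 [p1 [p1surj p1ker]]]] [m2 [n2 [g2 [p2 [p2surj p2ker]]]]].
have [p pE] : exists p : {linear 'rV[R^c]_(n1 + n2) -> (F * G)%type},
    p =1 fun v => (p1 (lsubmx v), p2 (rsubmx v)).
  by apply: linear_of => r x y; rewrite !linearP.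
have [g gE] : exists g : {linear 'rV[R^c]_(m1 + m2) -> 'rV[R^c]_(n1 + n2)},
    g =1 fun v => row_mx (g1 (lsubmx v)) (g2 (rsubmx v)).
  by apply: linear_of => r x y; rewrite !linearP scale_row_mx add_row_mx.
exists (m1 + m2)%N, (n1 + n2)%N, g, p; split=> [[x y]|v].
  have [u <-] := p1surj x; have [v <-] := p2surj y.
  by exists (row_mx u v); rewrite pE row_mxKl row_mxKr.
rewrite pE; split.
  case=> /p1ker[w1 e1] /p2ker[w2 e2]; exists (row_mx w1 w2).
  by rewrite gE row_mxKl row_mxKr -e1 -e2 hsubmxK.
case=> w ->; rewrite gE row_mxKl row_mxKr; congr (_, _).
  by apply/p1ker; exists (lsubmx w).
by apply/p2ker; exists (rsubmx w).
Qed.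
Definition prod_fpmod (F G : fpmod R) : fpmod R := FPMod (prod_fp (fp_fp F) (fp_fp G)).

(** Lifts to [R^n] of the images of generators of [F] are added to the relations
    of [G]. *)
Lemma coker_fp (F G Q : lmodType R^c) (f : {linear F -> G}) (q : {linear G -> Q}) :
  finitely_presented F -> finitely_presented G ->
  (forall z, exists y, q y = z) -> (forall y, q y = 0 <-> exists x, y = f x) ->
  finitely_presented Q.
Proof.
move=> [_ [k [_ [e [esurj _]]]]] [m [n [g [p [psurj pker]]]]] qsurj qker.
have [l lE] := row_lift (f \o e) psurj.
exists (m + k)%N, n, ((g \o lsubmx) \+ (l \o rsubmx)), (q \o p); split=> [z|v] /=.
  by have [y <-] := qsurj z; have [v <-] := psurj y; exists v.
split.
  case/qker=> x; have [w <-] := esurj x => pv.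
  have /pker[w' e'] : p (v - l w) = 0 by rewrite linearB lE pv subrr.
  by exists (row_mx w' w); rewrite row_mxKl row_mxKr -e' subrK.
case=> w ->; apply/qker; exists (e (rsubmx w)).
have /= := lE (rsubmx w); rewrite linearD => ->.
suff -> : p (g (lsubmx w)) = 0 by rewrite add0r.
by apply/pker; exists (lsubmx w).
Qed.

Variable M : rmod (ringcat R).

(** Two maps [F -> M] and [G -> M] factor through the sum [F * G], and a map
    [G -> M] that kills the image of [F -> G] factors through the cokernel; both
    modules are finitely presented. *)
Lemma yoneda_filtered : filtered_elements (yoneda_rmod M).
Proof.
split; first by split; exact: reg_fpmod.
- move=> F G x y.
  have [i iE] : exists i : {linear F -> (F * G)%type}, i =1 fun u => (u, 0).
    by apply: linear_of => r u v; congr (_, _); rewrite /= scaler0 addr0.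
  have [j jE] : exists j : {linear G -> (F * G)%type}, j =1 fun u => (0, u).
    by apply: linear_of => r u v; congr (_, _); rewrite /= scaler0 addr0.
  have [z zE] : exists z : {linear (F * G)%type -> rmod_lmod M},
      z =1 fun u => x u.1 + y u.2.
    by apply: linear_of => r u v; rewrite /= !linearP addrACA scalerDr.
  exists (prod_fpmod F G), i, j, z; split; apply: linear_ext => u.
    by rewrite -[LHS]/(z (i u)) iE zE /= linear0 addr0.
  by rewrite -[LHS]/(z (j u)) jE zE /= linear0 add0r.
- move=> F G f x xf0.
  have [q [qsurj qker]] := linear_cokernel (f : {linear F -> G}).
  pose Q := FPMod (coker_fp (fp_fp F) (fp_fp G) qsurj qker).
  have [u /qker[v ->]|z zE] := linear_factor (h := x) qsurj.
    exact: (congr1 (fun h : {linear F -> rmod_lmod M} => h v) xf0).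
  exists Q, q, z; split; apply: linear_ext => u; first exact: zE.
  by apply/qker; exists u.
Qed.

Lemma yoneda_flat : flat (yoneda_rmod M).
Proof. exact: filtered_flat yoneda_filtered. Qed.
End FinitelyPresented.

(** * Flat functors on finitely presented modules are Hom-functors *)

Section Point.
Variable R : pzRingType.
Definition point (F : modfp R) (y : fp_lmod F) : @phom (modfp R) (reg_fpmod R) F :=
  hat y.
Lemma pointD (F : modfp R) (x y : fp_lmod F) : point (x + y) = point x + point y.
Proof. exact: hatD. Qed.
Lemma comp_point (F G : modfp R) (f : {linear fp_lmod F -> fp_lmod G}) y :
  pcomp (f : @phom (modfp R) F G) (point y) = point (f y).
Proof. exact: comp_hat. Qed.
Lemma point_eta (F : modfp R) (f : {linear (R^c)^o -> fp_lmod F}) :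
  (f : @phom (modfp R) (reg_fpmod R) F) = point (f 1).
Proof. exact: hat_eta. Qed.

Variable N : rmod (modfp R).

Let act (r : R) : {additive N (reg_fpmod R) -> N (reg_fpmod R)} :=
  ract N (point (F := reg_fpmod R) (r : (R^c)^o)).
Lemma point_actD r s x : act (r + s) x = act r x + act s x.
Proof. by rewrite /act -ractD; congr (ract N _ x); exact: pointD. Qed.
Lemma point_act1 x : act 1 x = x.
Proof.
rewrite /act -[RHS](ract1 (r := N)); congr (ract N _ x).
by apply: linear_ext => r; rewrite /point hatE; exact: mulr1.
Qed.
Lemma point_actM r s x : act (r * s) x = act s (act r x).
Proof.
by rewrite /act -ractM comp_point; congr (ract N (point _) x).
Qed.
(** The value at the regular module, on which [r] acts through left
    multiplication by [r], an endomorphism of the right module [R]. *)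
Definition reg_value : rmod (ringcat R) :=
  @RMod (ringcat R) (fun _ => N (reg_fpmod R)) (fun _ _ r => act r)
    (fun _ _ => point_actD) (fun _ => point_act1) (fun _ _ _ => point_actM).

Section At.
Variable F : modfp R.
Section Elt.
Variable x : N F.
(** The comparison map [N F -> Hom(F, N R)] sends [x] to the map that restricts [x]
    along the points [R -> F]. *)
Definition values_fun (y : fp_lmod F) : rmod_lmod reg_value := ract N (point y) x.
Lemma values_linear : linear values_fun.
Proof.
move=> r y z; rewrite /values_fun pointD ractD; congr (_ + _).
rewrite -[RHS]/(ract N (point (F := reg_fpmod R) (r : (R^c)^o)) (ract N (point y) x)).
by rewrite -ractM comp_point; congr (ract N (point _) x); rewrite /point hatE.
Qed.
HB.instance Definition _ :=
  GRing.isLinear.Build R^c (fp_lmod F) (rmod_lmod reg_value) *:%R values_fun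
    values_linear.
Definition values : {linear fp_lmod F -> rmod_lmod reg_value} := values_fun.
End Elt.
Lemma values_additive : zmod_morphism values.
Proof. by move=> x y; apply: linear_ext => u; exact: raddfB. Qed.
HB.instance Definition _ :=
  GRing.isZmodMorphism.Build (N F) {linear fp_lmod F -> rmod_lmod reg_value}
    values values_additive.
End At.
Lemma values_nat (F G : modfp R) (f : @phom (modfp R) F G) x :
  values (ract N f x) = ract (yoneda_rmod reg_value) f (values x).
Proof.
apply: linear_ext => y.
rewrite -[LHS]/(ract N (point y) (ract N f x)) -ractM.
exact: (congr1 (fun h => ract N h x) (comp_point (f : {linear _ -> _}) y)).
Qed.
Definition values_rhom : rhom N (yoneda_rmod reg_value) :=
  @RHom (modfp R) N (yoneda_rmod reg_value) (fun F => @values F) values_nat.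

Hypothesis Nflat : flat N.

Lemma row_coord n : exists c : 'I_n -> {linear 'rV[R^c]_n -> (R^c)^o},
  forall i v, c i v = v 0 i.
Proof.
have cP (i : 'I_n) : exists c : {linear 'rV[R^c]_n -> (R^c)^o}, c =1 fun v => v 0 i.
  by apply: linear_of => r u v; rewrite !mxE.
by exists (fun i => sval (cid (cP i))) => i v; case: cid.
Qed.

Lemma ract_sum (I : finType) (F G : modfp R) (f : I -> @phom (modfp R) F G) x :
  ract N (\sum_i f i) x = \sum_i ract N (f i) x.
Proof.
by elim/big_rec2: _ => [|i h h' _ <-]; [exact: ract0|exact: ractD].
Qed.

(** An additive functor preserves the biproduct decomposition of [R^n]. *)
Lemma values_row_bij n :
  injective (@values (row_fpmod R n)) /\
  forall k : {linear 'rV[R^c]_n -> rmod_lmod reg_value},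
    exists w : N (row_fpmod R n), values w = k.
Proof.
have [c cE] := row_coord n.
pose C i : @phom (modfp R) (row_fpmod R n) (reg_fpmod R) := c i.
split.
- move=> w w' e.
  have sumC : pid (row_fpmod R n : modfp R) =
      \sum_i pcomp (point (F := row_fpmod R n) (delta_mx 0 i)) (C i).
    apply: linear_ext => v; rewrite -[LHS]/v [LHS]row_sum_delta.
    rewrite [RHS]lin_sumE.
    by apply: eq_bigr => i _; rewrite -[RHS]/(c i v *: delta_mx 0 i) cE.
  rewrite -[w](ract1 (r := N)) -[w'](ract1 (r := N)) sumC !ract_sum.
  apply: eq_bigr => i _; rewrite !ractM; congr (ract N (C i) _).
  exact: (congr1 (fun h : {linear 'rV[R^c]_n -> rmod_lmod reg_value} =>
    h (delta_mx 0 i)) e).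
- move=> k; exists (\sum_i ract N (C i) (k (delta_mx 0 i))).
  rewrite raddf_sum; apply: linear_ext => v.
  rewrite (lin_comb k) /comb.
  rewrite [LHS]lin_sumE.
  apply: eq_bigr => i _.
  rewrite -[LHS]/(values (ract N (C i) (k (delta_mx 0 i))) v) values_nat.
  by rewrite -[LHS]/(values (k (delta_mx 0 i)) (c i v)) cE.
Qed.

(** In a presentation [R^m -> R^n -> F -> 0] the map [R^n -> F] is a cokernel, so
    that [N F] and [Hom(F, N R)] are the kernels of the maps induced by
    [R^m -> R^n]; on free modules the comparison is bijective. *)
Lemma values_bij (F : modfp R) :
  injective (@values F) /\
  forall k : {linear fp_lmod F -> rmod_lmod reg_value}, exists x : N F, values x = k.
Proof.
have [m [n [g [p [psurj pker]]]]] := fp_fp F.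
pose G : @phom (modfp R) (row_fpmod R m) (row_fpmod R n) := g.
pose P : @phom (modfp R) (row_fpmod R n) F := p.
have PG0 : pcomp P G = 0 by apply: linear_ext => v; apply/pker; exists v.
have P_epi (K : modfp R) (k : @phom (modfp R) F K) : pcomp k P = 0 -> k = 0.
  move=> kP0; apply: linear_ext => y; have [v <-] := psurj y.
  exact: (congr1 (fun h : {linear 'rV[R^c]_n -> fp_lmod K} => h v) kP0).
have P_factor (K : modfp R) (h : @phom (modfp R) (row_fpmod R n) K) :
    pcomp h G = 0 -> exists k : @phom (modfp R) F K, h = pcomp k P.
  move=> hG0; have [u /pker[v ->]|k kE] := linear_factor
      (h := (h : {linear 'rV[R^c]_n -> fp_lmod K})) psurj.
    exact: (congr1 (fun h : {linear 'rV[R^c]_m -> fp_lmod K} => h v) hG0).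
  by exists k; apply: linear_ext => v; rewrite -[LHS]kE.
have [ninj nsurj] := values_row_bij n; have [minj _] := values_row_bij m.
split=> [x y e|k].
  apply: (flat_ract_inj Nflat P_epi); apply: ninj.
  by rewrite !values_nat e.
have [w wE] := nsurj (lin_comp k p).
have : ract N G w = 0.
  apply: minj; rewrite values_nat wE raddf0; apply: linear_ext => v.
  rewrite -[LHS]/(k (p (g v))).
  have -> : p (g v) = 0 by apply/pker; exists v.
  by rewrite linear0.
case/(flat_ract_ker Nflat PG0 P_epi P_factor) => x wx; exists x.
apply: linear_ext => y; have [v <-] := psurj y.
have := congr1 (fun h : {linear 'rV[R^c]_n -> rmod_lmod reg_value} => h v) wE.
by rewrite wx values_nat.
Qed.
End Point.

(** * The Yoneda functor is fully faithful *)

Section Isomorphisms.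

Lemma additive_of (U V : zmodType) (f : U -> V) :
  zmod_morphism f -> exists F : {additive U -> V}, F =1 f.
Proof.
move=> fB; pose m := GRing.isZmodMorphism.Build U V f fB.
by pose F : {additive U -> V} := HB.pack f m; exists F.
Qed.

Lemma rhom_bij_inv (A : preadd) (M N : rmod A) (f : rhom M N) :
  (forall a, injective (f a) /\ forall y, exists x, f a x = y) ->
  exists g : rhom N M, (forall a x, g a (f a x) = x) /\ (forall a y, f a (g a y) = y).
Proof.
move=> fbij; pose g0 a y := sval (cid ((fbij a).2 y)).
have fg0 a y : f a (g0 a y) = y by rewrite /g0; case: cid.
have g0B a : zmod_morphism (g0 a).
  by move=> x y; apply: (fbij a).1; rewrite raddfB !fg0.
pose g1 a := sval (cid (additive_of (g0B a))).
have fg1 a y : f a (g1 a y) = y by rewrite /g1; case: cid => h /= hE; rewrite hE fg0.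
have g1nat a b (h : phom a b) x : g1 a (ract N h x) = ract M h (g1 b x).
  by apply: (fbij a).1; rewrite rhnat !fg1.
exists (@RHom A N M g1 g1nat); split=> // a x.
by apply: (fbij a).1; rewrite fg1.
Qed.

Lemma shom_bij_iso (C : category) (S : representation C) (M N : Mod S)
    (f : shom (M : smod S) N) :
  (forall c a, injective (f c a) /\ forall y, exists x, f c a x = y) ->
  is_iso (f : hom M N).
Proof.
move=> fbij.
pose g c := sval (cid (rhom_bij_inv (fbij c))).
have gf c a x : g c a (f c a x) = x by rewrite /g; case: cid => h [].
have fg c a y : f c a (g c a y) = y by rewrite /g; case: cid => h [].
have gnat c d (al : hom c d) (a : S c) (y : (N : smod S) c a) :
    smmap (M : smod S) al a (g c a y) =
    g d (rep_map S al a) (smmap (N : smod S) al a y).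
  by apply: (fbij d _).1; rewrite -shnat !fg.
exists (@SHom C S N M g gnat).
by split; apply: shom_ext => c a x /=; rewrite ?gf ?fg.
Qed.
End Isomorphisms.

(** [R (x)_R S] is free over [S] on this element; restricting along its point
    identifies the value at [R (x)_R S] with the value at [S]. *)
Definition unit_tens (R S : pzRingType) (phi : {rmorphism R -> S}) :
    base_change phi (R^c)^o :=
  @bc_tens R S phi (R^c)^o 1 1.

Section FullyFaithful.
Variables (C : category) (R : ring_rep C).
Notation Rrep := (ring_representation R).
Notation Rfp := (fp_representation R).
Variables M N : smod Rrep.

Lemma yoneda_faithful (f f' : shom M N) : yoneda_shom f = yoneda_shom f' -> f = f'.
Proof.
move=> e; apply: shom_ext => c [] x.
have := congr1 (fun h : shom (yoneda_obj M) (yoneda_obj N) =>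
  (h c (reg_fpmod (R c)) (hat (x : rmod_lmod (M c))) :
     {linear ((R c)^c)^o -> rmod_lmod (N c)}) 1) e.
by rewrite -[LHS]/(f c tt (hat (x : rmod_lmod (M c)) 1))
           -[RHS]/(f' c tt (hat (x : rmod_lmod (M c)) 1)) hat1.
Qed.

Section Full.
Variable g : shom (yoneda_obj M) (yoneda_obj N).

Let g_ c (F : modfp (R c)) (f : {linear fp_lmod F -> rmod_lmod (M c)}) :
  {linear fp_lmod F -> rmod_lmod (N c)} := g c F f.

Let g_nat c (F G : modfp (R c)) (h : {linear fp_lmod F -> fp_lmod G}) f y :
  @g_ c F (lin_comp f h) y = @g_ c G f (h y).
Proof.
exact: (congr1 (fun k : {linear fp_lmod F -> rmod_lmod (N c)} => k y)
  (rhnat (g c) (h : @phom (modfp (R c)) F G) f)).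
Qed.

(* By naturality [g] is determined by its values on the maps out of the regular
   module, that is, on elements of M. *)
Let g_point c (F : modfp (R c)) f y :
  @g_ c F f y = @g_ c (reg_fpmod (R c)) (hat (f y)) 1.
Proof. by rewrite -comp_hat g_nat hat1. Qed.

(** The preimage sends [x] to [g] of its point, evaluated at 1.  It commutes with
    the structure maps of [M] and [N] because [g] does so at the regular module,
    where both sides are compared on the generator of [R (x)_R S]. *)
Lemma yoneda_full : exists f : shom M N, yoneda_shom f = g.
Proof.
have hP c : exists h : {additive M c tt -> N c tt},
    h =1 fun x => @g_ c (reg_fpmod (R c)) (hat (x : rmod_lmod (M c))) 1.
  apply: additive_of => x y.
  have -> : hat (x - y : rmod_lmod (M c)) =
      hat (x : rmod_lmod (M c)) - hat (y : rmod_lmod (M c)).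
    by apply/eqP; rewrite eq_sym subr_eq -hatD subrK.
  exact: (congr1 (fun k : {linear ((R c)^c)^o -> rmod_lmod (N c)} => k 1)
    (raddfB (g c (reg_fpmod (R c))) (hat (x : rmod_lmod (M c)))
       (hat (y : rmod_lmod (M c))))).
pose h c := sval (cid (hP c)).
have hE c x : h c x = @g_ c (reg_fpmod (R c)) (hat (x : rmod_lmod (M c))) 1.
  by rewrite /h; case: cid.
pose h' c (a : ringcat (R c)) : {additive M c a -> N c a} :=
  match a with tt => h c end.
have h'nat c (a b : ringcat (R c)) (r : phom a b) x :
    h' c a (ract (M c) r x) = ract (N c) r (h' c b x).
  case: a b r x => -[] r x; rewrite /= !hE.
  rewrite -[RHS]/((r : (R c)^c) *: (_ : rmod_lmod (N c))) -linearZ /=.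
  have gx := @g_point c (reg_fpmod (R c)) (hat (x : rmod_lmod (M c))).
  apply: (etrans _ (esym (gx _))).
  congr (@g_ c (reg_fpmod (R c)) (hat _) 1).
  exact: (congr1 (fun s => ract (M c) s x) (esym (mul1r (r : R c)))).
pose hr c : rhom (M c) (N c) := @RHom _ _ _ (h' c) (h'nat c).
have hsnat c d (al : hom c d) (a : Rrep c) (x : M c a) :
    smmap N al a (hr c a x) = hr d (rep_map Rrep al a) (smmap M al a x).
  case: a x => x; rewrite /= !hE.
  have := congr1 (fun k : {linear base_change (rr_map R al) ((R c)^c)^o ->
       rmod_lmod (N d)} => k (unit_tens _))
    (shnat g al (a := reg_fpmod (R c)) (hat (x : rmod_lmod (M c)))).
  rewrite -[X in X = _]/(yon_adj (smmap N al)
     (@g_ c (reg_fpmod (R c)) (hat (x : rmod_lmod (M c)))) _).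
  rewrite yon_adjE scale1r => e; apply: (etrans e).
  rewrite -[LHS]/(@g_ d (bc_fpmod _ (reg_fpmod (R c)))
    (yon_adj (smmap M al) (hat (x : rmod_lmod (M c)))) (unit_tens _)).
  by rewrite g_point yon_adjE scale1r hat1.
exists (@SHom C Rrep M N hr hsnat).
apply: shom_ext => c F f; apply: linear_ext => y.
rewrite -[LHS]/(h c (f y)) hE; exact/esym/g_point.
Qed.
End Full.
End FullyFaithful.

(** * Essential surjectivity onto the locally flat modules *)

Lemma bc_map_hat_unit (R S : pzRingType) (phi : {rmorphism R -> S}) (F : lmodType R^c)
    (y : F) : bc_map phi (hat y) (unit_tens phi) = bc_tens phi y 1.
Proof. by rewrite bc_mapE hat1. Qed.

Lemma bc_tens_unit (R S : pzRingType) (phi : {rmorphism R -> S}) (F : lmodType R^c)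
    (y : F) (s : S) : bc_tens phi y s = (s : S^c) *: bc_map phi (hat y) (unit_tens phi).
Proof. by rewrite bc_map_hat_unit -bc_tens_scale mul1r. Qed.

Lemma bc_map_scale_unit (R S : pzRingType) (phi : {rmorphism R -> S}) (r : R) :
  bc_map phi (hat (r : (R^c)^o)) (unit_tens phi) = (phi r : S^c) *: unit_tens phi.
Proof.
have [_ _ tb] := bc_tens_balanced phi (R^c)^o.
have e : (r : (R^c)^o) = (r : R^c) *: (1 : (R^c)^o) by exact: (esym (mul1r (r : R))).
by rewrite bc_map_hat_unit {1}e tb mulr1 /unit_tens -bc_tens_scale mul1r.
Qed.

Section EssentiallySurjective.
Variables (C : category) (R : ring_rep C).
Notation Rrep := (ring_representation R).
Notation Rfp := (fp_representation R).
Variable N : smod Rfp.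

Section Map.
Variables (c d : C) (al : hom c d).
Let u : @phom (modfp (R d)) (reg_fpmod (R d))
    (bc_fpmod (rr_map R al) (reg_fpmod (R c))) :=
  point (F := bc_fpmod (rr_map R al) (reg_fpmod (R c))) (unit_tens (rr_map R al)).

(** [N_c(R_c) -> N_d(R_c (x) R_d) = N_d(R_d)]. *)
Definition reg_map_fun (x : N c (reg_fpmod (R c))) : N d (reg_fpmod (R d)) :=
  ract (N d) u (smmap N al (reg_fpmod (R c)) x).
Lemma reg_map_additive : zmod_morphism reg_map_fun.
Proof. by move=> x y; rewrite /reg_map_fun !raddfB. Qed.
HB.instance Definition _ :=
  GRing.isZmodMorphism.Build _ _ reg_map_fun reg_map_additive.

Lemma reg_map_point (F : modfp (R c)) (y : fp_lmod F) (x : N c F) :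
  reg_map_fun (ract (N c) (point y) x) =
  ract (N d) (point (F := bc_fpmod (rr_map R al) F) (bc_tens _ y 1))
    (smmap N al F x).
Proof.
rewrite /reg_map_fun.
have -> : smmap N al (reg_fpmod (R c)) (ract (N c) (point y) x) =
  ract (N d) (bc_map (rr_map R al) (hat y) :
      @phom (modfp (R d)) (bc_fpmod _ (reg_fpmod (R c))) (bc_fpmod _ F))
    (smmap N al F x).
  exact: (rhnat (smmap N al) (point y) x).
by rewrite -ractM comp_point bc_map_hat_unit.
Qed.

Lemma reg_map_nat (r : R c) x :
  reg_map_fun (ract (N c) (point (F := reg_fpmod (R c)) (r : ((R c)^c)^o)) x) =
  ract (N d) (point (F := reg_fpmod (R d)) (rr_map R al r : ((R d)^c)^o))
    (reg_map_fun x).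
Proof.
rewrite reg_map_point /reg_map_fun -ractM comp_point -bc_map_hat_unit bc_map_scale_unit.
by congr (ract _ (point _) _).
Qed.

Definition reg_map :
    rhom (reg_value (N c)) (pull (ringfun (rr_map R al)) (reg_value (N d))) :=
  @RHom (ringcat (R c)) (reg_value (N c))
    (pull (ringfun (rr_map R al)) (reg_value (N d)))
    (fun _ => reg_map_fun) (fun _ _ => reg_map_nat).
End Map.

Lemma reg_mu c d e (be : hom d e) (al : hom c d) (a : Rrep c)
    (x : reg_value (N c) a) :
  reg_map be (rep_map Rrep al a) (reg_map al a x) =
  ract (reg_value (N e)) (rep_mu Rrep be al a) (reg_map (comp be al) a x).
Proof.
rewrite (ract1 (r := reg_value (N e))).
rewrite -[LHS]/(reg_map_fun be (ract (N d) (point (F := bc_fpmod _ (reg_fpmod (R c)))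
   (unit_tens (rr_map R al))) (smmap N al (reg_fpmod (R c)) x))).
rewrite reg_map_point.
rewrite (@sm_mu C Rfp N c d e be al (reg_fpmod (R c)) x) -ractM.
congr (ract (N e) _ _).
apply: (etrans (@comp_point (R e)
  (bc_fpmod (rr_map R be) (bc_fpmod (rr_map R al) (reg_fpmod (R c))))
  (bc_fpmod (rr_map R (comp be al)) (reg_fpmod (R c)))
  (fp_mu be al (reg_fpmod (R c))) _)).
by rewrite bc_muE rmorph1 mulr1.
Qed.

Lemma reg_delta c (a : Rrep c) (x : reg_value (N c) a) :
  ract (reg_value (N c)) (rep_delta Rrep a) (reg_map (idm c) a x) = x.
Proof.
rewrite (ract1 (r := reg_value (N c))) -[RHS](@sm_delta C Rfp N c (reg_fpmod (R c)) x).
congr (ract (N c) _ _).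
exact/esym/(point_eta (F := bc_fpmod _ (reg_fpmod (R c)))
  (fp_delta (R := R) (reg_fpmod (R c)))).
Qed.

Definition reg_smod : smod Rrep :=
  @SMod C Rrep (fun c => reg_value (N c)) reg_map reg_mu reg_delta.

(** Both sides are linear over [R d], hence need only be compared at [y (x) 1],
    where [reg_map_point] applies. *)
Lemma values_shnat c d (al : hom c d) (F : Rfp c) (x : N c F) :
  smmap (yoneda_obj reg_smod) al F (values_rhom (N c) F x) =
  values_rhom (N d) (rep_map Rfp al F) (smmap N al F x).
Proof.
apply: bc_linear_ext => y s.
rewrite -[LHS]/(yon_adj (smmap reg_smod al) (values x) (bc_tens _ y s)) yon_adjE.
rewrite -[RHS]/(@values (R d) (N d) (bc_fpmod (rr_map R al) F) (smmap N al F x)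
  (bc_tens _ y s)).
rewrite bc_tens_unit linearZ; congr (_ *: _).
rewrite -[LHS]/(reg_map_fun al (ract (N c) (point y) x)).
by rewrite reg_map_point bc_map_hat_unit.
Qed.

Definition values_shom : shom N (yoneda_obj reg_smod) :=
  @SHom C Rfp N (yoneda_obj reg_smod) (fun c => values_rhom (N c)) values_shnat.

Lemma yoneda_esurj : locally_flat (N : Mod Rfp) ->
  exists g : @hom (Mod Rfp) (Yoneda R reg_smod) N, is_iso g.
Proof.
move=> Nflat.
have [|g [gf fg]] := @shom_bij_iso C Rfp N (yoneda_obj reg_smod) values_shom.
  by move=> c F; exact: (values_bij (Nflat c)).
by exists g, values_shom.
Qed.
End EssentiallySurjective.

(** * Cartesian modules *)

Lemma sum_congr_map (T T' : Type) (rel : seq T -> seq T -> Prop)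
    (rel' : seq T' -> seq T' -> Prop) (f : T -> T') :
  (forall u v, rel u v -> sum_congr rel' (map f u) (map f v)) ->
  forall u v, sum_congr rel u v -> sum_congr rel' (map f u) (map f v).
Proof.
move=> frel u v; elim=> {u v} [//|u|u v _|u v w _ + _|u u' v v' _ iu _ iv|u v].
- exact: sc_refl.
- exact: sc_sym.
- exact: sc_trans.
- by rewrite !map_cat; exact: sc_cat.
- by rewrite !map_cat; exact: sc_comm.
Qed.

Section TensorMapLeft.
Variables (A : preadd) (M M' : rmod A).

Definition tmapl (s : rhom M M') (L : lmod A) (u : tsum M L) : tsum M' L :=
  [seq tgen (s _ (tagged g).1) (tagged g).2 | g <- u].

Lemma tmapl_teq (s : rhom M M') (L : lmod A) (u v : tsum M L) :
  teq u v -> teq (tmapl s u) (tmapl s v).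
Proof.
apply: sum_congr_map => {u v} u v [a x x' y|a x y y'|a y|a b h x y];
  apply: sc_base => /=.
- by rewrite raddfD; exact: trel_Dl.
- exact: trel_Dr.
- by rewrite raddf0; exact: trel_0.
- by rewrite rhnat; exact: trel_bal.
Qed.

End TensorMapLeft.

Section Transfer.
Variables (A B : preadd) (phi : add_functor A B).
Variables (M M' : rmod A) (N N' : rmod B).
Variables (f : rhom M (pull phi N)) (f' : rhom M' (pull phi N')).
Variables (s : rhom M M') (s' : rhom M' M) (t : rhom N N').
Hypothesis s'K : forall a x, s a (s' a x) = x.
Hypothesis t_bij : forall b, injective (t b) /\ forall y, exists x, t b x = y.
Hypothesis compat : forall a x, f' a (s a x) = t (phi a) (f a x).

Lemma adjoint_tmapl b (u : tsum M (corep phi b)) :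
  adjoint f' (tmapl s u) = t b (adjoint f u).
Proof.
rewrite /adjoint big_map raddf_sum; apply: eq_bigr => -[a [x h]] _ /=.
by rewrite compat -rhnat.
Qed.

Lemma adjoint_is_iso_transfer : adjoint_is_iso f -> adjoint_is_iso f'.
Proof.
move=> fiso b; have [finj fsurj] := fiso b; have [tinj tsurj] := t_bij b.
have sK (u : tsum M' (corep phi b)) : tmapl s (tmapl s' u) = u.
  rewrite /tmapl -map_comp -[RHS]map_id; apply: eq_map => -[a [x h]] /=.
  by rewrite s'K.
split=> [u v|y].
  rewrite -[u]sK -[v]sK !adjoint_tmapl => /tinj/finj.
  exact: tmapl_teq.
have [x <-] := tsurj y; have [u <-] := fsurj x.
by exists (tmapl s u); rewrite adjoint_tmapl.
Qed.
End Transfer.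

Section BaseChangeMapE.
Variables (R S : pzRingType) (phi : {rmorphism R -> S}).
Lemma bc_map_addE (F G : lmodType R^c) (f f' : {linear F -> G}) z :
  bc_map phi (f + f') z = bc_map phi f z + bc_map phi f' z.
Proof. by rewrite raddfD. Qed.
Lemma bc_map_0E (F G : lmodType R^c) z :
  bc_map phi (0 : {linear F -> G}) z = 0.
Proof. by rewrite raddf0. Qed.
Lemma bc_map_compE (F G H : lmodType R^c) (f : {linear G -> H})
    (g : {linear F -> G}) z :
  bc_map phi (lin_comp f g) z = bc_map phi f (bc_map phi g z).
Proof. by rewrite bc_map_comp. Qed.
End BaseChangeMapE.

Section Comparison.
Variables (R S : pzRingType) (phi : {rmorphism R -> S}).
Variables (M : rmod (ringcat R)) (N : rmod (ringcat S)).
Variable m : rhom M (pull (ringfun phi) N).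

Notation YM := (yoneda_rmod M).
Notation L b := (corep (bc_functor phi) b).
Notation ring_tsum := (tsum M (corep (ringfun phi) tt)).

(** The tensor of [f : F -> M] and [h : b -> F (x)_R S] in
    [Hom(-, M) (x) Hom(b, - (x)_R S)]. *)
Definition gen (F : modfp R) (f : {linear fp_lmod F -> rmod_lmod M}) (b : modfp S)
    (h : {linear fp_lmod b -> base_change phi (fp_lmod F)}) :
    {F : modfp R & (YM F * L b F)%type} :=
  @tgen (modfp R) YM (L b) F f h.

Lemma gen_bal (F G : modfp R) (g : {linear fp_lmod F -> fp_lmod G})
    (f : {linear fp_lmod G -> rmod_lmod M}) (b : modfp S)
    (h : {linear fp_lmod b -> base_change phi (fp_lmod F)}) :
  teq [:: gen (lin_comp f g) h] [:: gen f (lin_comp (bc_map phi g) h)].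
Proof.
exact: sc_base (@trel_bal (modfp R) YM (L b) F G g f h).
Qed.

Definition ring_pair (g : {a : ringcat R & (M a * S)%type}) : rmod_lmod M * S :=
  match g with existT tt p => p end.

Definition to_yoneda1 (g : {a : ringcat R & (M a * S)%type}) :
    {F : modfp R & (YM F * L (reg_fpmod S) F)%type} :=
  @gen (reg_fpmod R) (hat (ring_pair g).1) (reg_fpmod S)
    (hat (((ring_pair g).2 : S^c) *: unit_tens phi)).

(** [M (x)_R S -> Hom(-, M) (x) Hom(S, - (x)_R S)] replaces [x] by its point and
    [s] by the point of [1 (x) s].  It is shown to be bijective, with inverse
    [f (x) h |-> (f (x) S)(h 1)]. *)
Definition to_yoneda (u : ring_tsum) : tsum YM (L (reg_fpmod S)) :=
  map to_yoneda1 u.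

Lemma to_yoneda_teq u v : teq u v -> teq (to_yoneda u) (to_yoneda v).
Proof.
apply: sum_congr_map => {u v} u v [[] x x' y|[] x y y'|[] y|[] [] r x y].
- rewrite /= /to_yoneda1 /= hatD; exact: sc_base (trel_Dl _ _ _).
- rewrite /= /to_yoneda1 /= (scalerDl _ (y : S^c) (y' : S^c)) hatD.
  exact: sc_base (trel_Dr _ _ _).
- rewrite /= /to_yoneda1 /=.
  have -> : hat (0 : rmod_lmod M) = 0.
    by apply: linear_ext => r; rewrite hatE scaler0.
  exact: sc_base (trel_0 _ _).
- rewrite /= /to_yoneda1 /=.
  have -> : hat (ract M r x : rmod_lmod M) =
      lin_comp (hat (x : rmod_lmod M)) (hat (r : (R^c)^o)).
    by rewrite comp_hat; congr hat.
  apply: sc_trans (@gen_bal (reg_fpmod R) (reg_fpmod R) (hat (r : (R^c)^o))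
    (hat (x : rmod_lmod M)) (reg_fpmod S) (hat ((y : S^c) *: unit_tens phi))) _.
  rewrite comp_hat linearZ /= bc_map_scale_unit scalerA.
  exact: sc_refl.
Qed.

Definition of_yoneda (u : tsum YM (L (reg_fpmod S))) : base_change phi (rmod_lmod M) :=
  \sum_(g <- u) bc_map phi ((tagged g).1 : {linear fp_lmod (tag g) -> rmod_lmod M})
    (((tagged g).2 : {linear (S^c)^o -> base_change phi (fp_lmod (tag g))}) 1).

Lemma of_yoneda_teq u v : teq u v -> of_yoneda u = of_yoneda v.
Proof.
rewrite /teq; elim => {u v} //.
- move=> u v [F f f' h|F f h h'|F h|F G g f h];
    rewrite /of_yoneda !big_cons !big_nil /= ?addr0.
  + exact: bc_map_addE.
  + by rewrite -linearD.
  + exact: bc_map_0E.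
  + exact: bc_map_compE.
- by move=> u v w _ -> _ ->.
- by move=> u u' v v' _ iu _ iv; rewrite /of_yoneda !big_cat; congr (_ + _).
- by move=> u v; rewrite /of_yoneda !big_cat /= addrC.
Qed.

Lemma of_to_yoneda (u : ring_tsum) :
  of_yoneda (to_yoneda u) =
  bc_cl phi (map ring_pair u).
Proof.
rewrite /of_yoneda big_map.
elim: u => [|[[] [x s]] u iu]; first by rewrite big_nil.
rewrite big_cons iu /= -cat1s bc_clD; congr (_ + _).
by rewrite hat1 linearZ /= -bc_tens_unit.
Qed.

Lemma to_yoneda_inj u v : teq (to_yoneda u) (to_yoneda v) -> teq u v.
Proof.
move/of_yoneda_teq; rewrite !of_to_yoneda => /bc_clP.
pose g (h : rmod_lmod M * S) :
    {a : ringcat R & (M a * corep (ringfun phi) tt a)%type} :=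
  @tgen (ringcat R) M (corep (ringfun phi) tt) tt h.1 h.2.
have gK (w : ring_tsum) : map g (map ring_pair w) = w.
  by rewrite -map_comp -[RHS]map_id; apply: eq_map => -[[] [x s]].
rewrite -{2}[u]gK -{2}[v]gK.
apply: sum_congr_map => {u v gK} u v [x x' s|x s s'|s|x r s] /=; apply: sc_base.
- exact: trel_Dl.
- exact: trel_Dr.
- exact: (@trel_0 (ringcat R) M (corep (ringfun phi) tt) tt).
- exact: (@trel_bal (ringcat R) M (corep (ringfun phi) tt) tt tt r x s).
Qed.

Lemma to_yoneda_surj w : exists u, teq (to_yoneda u) w.
Proof.
elim: w => [|[F [f h]] w [u uw]]; first by exists [::]; exact: sc_refl.
suff [v vh] : exists v, teq (to_yoneda v) [:: gen f h].
  by exists (v ++ u); rewrite /to_yoneda map_cat -cat1s; exact: sc_cat.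
rewrite (hat_eta h); elim/bc_ind: (h 1) => [|x s|y z [u1 uy] [u2 uz]].
- exists [::].
  have -> : hat (0 : base_change phi (fp_lmod F)) = 0.
    by apply: linear_ext => r; rewrite hatE scaler0.
  exact/sc_sym/(@tgenr0 (modfp R) YM (L (reg_fpmod S)) F f).
- exists [:: @tgen (ringcat R) M (corep (ringfun phi) tt) tt (f x) s].
  rewrite /= /to_yoneda1 /= -comp_hat.
  apply: sc_trans (@gen_bal (reg_fpmod R) F (hat x) f (reg_fpmod S)
    (hat ((s : S^c) *: unit_tens phi))) _.
  rewrite comp_hat linearZ /= -bc_tens_unit.
  exact: sc_refl.
- exists (u1 ++ u2); rewrite hatD /to_yoneda map_cat.
  apply: sc_trans (sc_cat uy uz) _.
  exact/sc_sym/sc_base/(@trel_Dr (modfp R) YM (L (reg_fpmod S)) F f (hat y) (hat z)).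
Qed.

Let ym := yoneda_adj m.
Let adj b (u : tsum YM (L b)) : {linear fp_lmod b -> rmod_lmod N} := adjoint ym u.

Lemma adj_gen F f b h : @adj b [:: @gen F f b h] = lin_comp (yon_adj m f) h.
Proof. by rewrite /adj /adjoint big_seq1. Qed.

(** Under the identification of both sides with their one-object counterparts, the
    adjoint of [Y(M)] at [S] is the adjoint of [M]. *)
Lemma adj_to_yoneda u : adj (to_yoneda u) = hat (adjoint m u : rmod_lmod N).
Proof.
rewrite /adj /adjoint big_map.
elim: u => [|[[] [x s]] u iu].
  by rewrite !big_nil; apply: linear_ext => r; rewrite hatE scaler0.
rewrite !big_cons hatD -iu; congr (_ + _).
rewrite -[LHS]/(lin_comp (yon_adj m (hat (x : rmod_lmod M)))
  (hat ((s : S^c) *: unit_tens phi))).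
rewrite comp_hat linearZ /= yon_adjE scale1r hat1.
by [].
Qed.

Definition bijective_at (b : modfp S) : Prop :=
  (forall u v : tsum YM (L b), adjoint ym u = adjoint ym v -> teq u v) /\
  (forall y : yoneda_rmod N b, exists u : tsum YM (L b), adjoint ym u = y).

Lemma bijective_at_reg : adjoint_is_iso m <-> bijective_at (reg_fpmod S).
Proof.
split.
  move=> miso; have [minj msurj] := miso tt; split=> [u v|y].
    have [u' uu'] := to_yoneda_surj u; have [v' vv'] := to_yoneda_surj v.
    rewrite -(adjoint_teq ym uu') -(adjoint_teq ym vv') => e.
    apply: sc_trans (sc_sym uu') (sc_trans _ vv'); apply/to_yoneda_teq/minj.
    have := congr1 (fun k : {linear (S^c)^o -> rmod_lmod N} => k 1) e.
    by rewrite -/(adj (to_yoneda u')) -/(adj (to_yoneda v')) !adj_to_yoneda !hat1.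
  have [u uE] := msurj ((y : {linear (S^c)^o -> rmod_lmod N}) 1).
  exists (to_yoneda u); rewrite -/(adj (to_yoneda u)) adj_to_yoneda uE.
  exact/esym/hat_eta.
case=> yinj ysurj []; split=> [u v e|y].
  by apply/to_yoneda_inj/yinj; rewrite -!/(adj (to_yoneda _)) !adj_to_yoneda e.
have [w wE] := ysurj (hat (y : rmod_lmod N)); have [u uw] := to_yoneda_surj w.
exists u; rewrite -[y](hat1 (y : rmod_lmod N)) -wE -(adjoint_teq ym uw).
by rewrite -/(adj (to_yoneda u)) adj_to_yoneda hat1.
Qed.

Section AllComponents.
Hypothesis reg_bij : bijective_at (reg_fpmod S).

(** Injectivity at [S] together with filteredness: an element of [F (x)_R S] that
    dies in [N] dies in [G (x)_R S] for some [F -> G -> M]. *)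
Lemma kill_element (F : fpmod R) (f : {linear F -> rmod_lmod M})
    (z : base_change phi F) : yon_adj m f z = 0 ->
  exists (G : fpmod R) (g : {linear F -> G}) (f' : {linear G -> rmod_lmod M}),
    lin_comp f' g = f /\ bc_map phi g z = 0.
Proof.
move=> fz0; have [yinj _] := reg_bij.
have : teq [:: gen (b := reg_fpmod S) f (hat z)] [:: gen (b := reg_fpmod S) f \0].
  apply: yinj; rewrite -!/(adj _) !adj_gen comp_hat fz0.
  by apply: linear_ext => r; rewrite hatE scaler0 -[RHS]/(yon_adj m f 0) linear0.
case/(tgen_teq (yoneda_filtered M)) => G [g [f' [f'g e]]].
exists G, g, f'; split=> //.
have := congr1 (fun k : {linear (S^c)^o -> base_change phi (fp_lmod G)} => k 1) e.
rewrite -[X in X = _]/(bc_map phi g (hat z 1)) hat1 => ->.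
exact: (linear0 (bc_map phi g)).
Qed.

Lemma yon_adj_comp (F G : fpmod R) (g : {linear F -> G})
    (f : {linear G -> rmod_lmod M}) z :
  yon_adj m (lin_comp f g) z = yon_adj m f (bc_map phi g z).
Proof.
exact: (congr1 (fun k : {linear base_change phi F -> rmod_lmod N} => k z)
  (yon_adj_nat m g f)).
Qed.

Lemma kill_family n (F : fpmod R) (f : {linear F -> rmod_lmod M})
    (z : 'I_n -> base_change phi F) : (forall i, yon_adj m f (z i) = 0) ->
  exists (G : fpmod R) (g : {linear F -> G}) (f' : {linear G -> rmod_lmod M}),
    lin_comp f' g = f /\ forall i, bc_map phi g (z i) = 0.
Proof.
elim: n F f z => [|n IHn] F f z fz0.
  by exists F, (lin_id F), f; split=> [|[]//]; exact: linear_ext.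
have [G [g [f' [f'g gz0]]]] := kill_element (fz0 ord0).
have [|H [h [f'' [f''h hz]]]] := IHn G f' (fun i => bc_map phi g (z (lift ord0 i))).
  by move=> i; rewrite -yon_adj_comp f'g.
exists H, (lin_comp h g), f''; split=> [|i].
  by rewrite -f'g -f''h; exact: linear_ext.
rewrite bc_map_compE; case: (unliftP ord0 i) => [j ->|->]; first exact: hz.
by rewrite gz0 linear0.
Qed.

(** Surjectivity at [S]: each element of [N] comes from a single [F (x)_R S]. *)
Lemma reach_element (y : rmod_lmod N) :
  exists (F : fpmod R) (f : {linear F -> rmod_lmod M}) z, yon_adj m f z = y.
Proof.
have [_ ysurj] := reg_bij; have [u uy] := ysurj (hat y).
have [F [f [h [/factors_teq uh _]]]] := cofactors_refl (yoneda_filtered M) u.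
exists F, f, ((h : {linear (S^c)^o -> base_change phi F}) 1).
rewrite -[RHS](hat1 y) -uy (adjoint_teq ym uh).
rewrite -[X in _ = (X : {linear _ -> _}) _]/(adj [:: gen (b := reg_fpmod S) f h]).
by rewrite adj_gen.
Qed.

Lemma reach_family n (y : 'I_n -> rmod_lmod N) :
  exists (F : fpmod R) (f : {linear F -> rmod_lmod M}) (z : 'I_n -> base_change phi F),
    forall i, yon_adj m f (z i) = y i.
Proof.
have [_ directed _] := yoneda_filtered M.
elim: n y => [|n IHn] y; first by exists (reg_fpmod R), (hat 0), (fun=> 0) => -[].
have [F [f [z fz]]] := IHn (fun i => y (lift ord0 i)).
have [G [g [w gw]]] := reach_element (y ord0).
have [H [i [j [h [hi hj]]]]] := directed F G f g.
exists H, h, (fun k => if unlift ord0 k is Some l then bc_map phi i (z l)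
                       else bc_map phi j w) => k.
case: unliftP => [l ->|->]; rewrite -yon_adj_comp.
  by rewrite -fz -hi.
by rewrite -gw -hj.
Qed.

(** A map from [b] to [N] or to [F (x)_R S] is given by finitely many elements
    subject to finitely many relations.  So two maps [b -> F (x)_R S] that agree in
    [N] agree at a later stage, and for a map [b -> N] the images of the generators
    are reached at one stage, after which the relations are enforced at a later
    one. *)
Lemma bijective_at_fp (b : fpmod S) : bijective_at b.
Proof.
have [k [n [g [p [psurj pker]]]]] := fp_fp b.
split=> [u v|y].
  have [F [f [h [h' [uh vh']]]]] := directed_factors (yoneda_filtered M) u v.
  move/factors_teq in uh; move/factors_teq in vh'.
  rewrite (adjoint_teq ym uh) (adjoint_teq ym vh') => e.
  have {}e : lin_comp (yon_adj m f) h = lin_comp (yon_adj m f) h'.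
    move: e; rewrite -[adjoint _ _]/(adj [:: gen f h]).
    by rewrite -[X in _ = X]/(adj [:: gen f h']) !adj_gen.
  have [i|G [a [f' [f'a az]]]] := @kill_family n F f
      (fun i => (h : {linear b -> base_change phi F}) (p (delta_mx 0 i)) -
                (h' : {linear b -> base_change phi F}) (p (delta_mx 0 i))).
    rewrite linearB; apply/eqP; rewrite subr_eq0; apply/eqP.
    exact: (congr1 (fun q : {linear b -> rmod_lmod N} => q _) e).
  have ah : lin_comp (bc_map phi a) h = lin_comp (bc_map phi a) h'.
    apply: linear_ext => x; have [w <-] := psurj x.
    apply: (@row_linear_ext _ _ _ ((bc_map phi a \o h) \o p)
      ((bc_map phi a \o h') \o p)).
    by move=> i /=; apply/eqP; rewrite -subr_eq0 -linearB; apply/eqP/az.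
  apply: sc_trans uh (sc_trans _ (sc_sym vh')).
  rewrite -f'a; apply: sc_trans (gen_bal a f' h) _; rewrite ah.
  exact: sc_sym (gen_bal a f' h').
have [F [f [z0 fz0]]] :=
  reach_family (fun i => (y : {linear b -> rmod_lmod N}) (p (delta_mx 0 i))).
have [z zE] := row_linear z0.
have fz w : yon_adj m f (z w) = (y : {linear b -> rmod_lmod N}) (p w).
  apply: (@row_linear_ext _ _ _ (yon_adj m f \o z)
    ((y : {linear b -> rmod_lmod N}) \o p)) => i /=.
  by rewrite zE fz0.
have [l|G [a [f' [f'a az]]]] := @kill_family k F f (fun l => z (g (delta_mx 0 l))).
  rewrite fz; have -> : p (g (delta_mx 0 l)) = 0 by apply/pker; exists (delta_mx 0 l).
  by rewrite linear0.
have [w /pker[w' ->]|h hE] := linear_factor (h := bc_map phi a \o z) psurj.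
  apply: (@row_linear_ext _ _ _ ((bc_map phi a \o z) \o g) \0) => l /=.
  exact: az.
exists [:: gen f' h].
rewrite -[adjoint _ _]/(adj [:: gen f' h]) adj_gen.
apply: linear_ext => x; have [w <-] := psurj x.
by rewrite -[LHS]/(yon_adj m f' (h (p w))) hE /= -yon_adj_comp f'a fz.
Qed.
End AllComponents.

Lemma yoneda_adj_is_iso : adjoint_is_iso m <-> adjoint_is_iso (yoneda_adj m).
Proof.
split=> [/bijective_at_reg mbij b|ybij]; first exact: bijective_at_fp.
by apply/bijective_at_reg; exact: ybij.
Qed.
End Comparison.

Section YonedaCartesian.
Variables (C : category) (R : ring_rep C).
Notation Rrep := (ring_representation R).
Notation Rfp := (fp_representation R).

Lemma yoneda_cartesian (M : Mod Rrep) : cartesian M <-> cartesian (Yoneda R M).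
Proof.
by split=> Mcart c d al; apply/yoneda_adj_is_iso; exact: Mcart.
Qed.

Lemma yoneda_locally_flat (M : Mod Rrep) : locally_flat (Yoneda R M).
Proof. by move=> c; exact: yoneda_flat. Qed.

(** [N] is isomorphic to the image of [reg_smod N], and being cartesian is
    invariant under isomorphism and reflected by the Yoneda functor. *)
Lemma reg_smod_cartesian (N : Mod Rfp) :
  locally_flat N -> cartesian N -> cartesian (reg_smod N : Mod Rrep).
Proof.
move=> Nflat Ncart; apply/yoneda_cartesian => c d al.
have vbij e (F : Rfp e) := values_bij (Nflat e) F.
have [s' [_ s'K]] := rhom_bij_inv (f := values_rhom ((N : smod Rfp) c)) (vbij c).
apply: (adjoint_is_iso_transfer (s := values_rhom ((N : smod Rfp) c))
  (t := values_rhom ((N : smod Rfp) d)) s'K (vbij d) _ (Ncart c d al)).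
exact: values_shnat.
Qed.
End YonedaCartesian.

Theorem theorem4p13 (C : category) (R : ring_rep C) :
  exists (Yflat : forall M : Mod (ring_representation R),
            locally_flat (Yoneda R M))
         (Ycart : forall M : Mod (ring_representation R),
            cartesian M -> cartesian (Yoneda R M)),
    is_equivalence
      (corestriction Yflat
        : functor (Mod (ring_representation R)) (LFlat (fp_representation R))) /\
    is_equivalence
      (corestriction (F := restriction Ycart)
         (Q := fun N : Mod_cart (fp_representation R) => locally_flat (sval N))
         (fun M : Mod_cart (ring_representation R) => Yflat (sval M))
        : functor (Mod_cart (ring_representation R))
                  (LFlat_cart (fp_representation R))).
Proof.
exists (@yoneda_locally_flat C R), (fun M => (yoneda_cartesian M).1).
split; apply: fully_faithful_esurj_equivalence.
- by move=> M N g; exact: yoneda_full.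
- by move=> M N f f'; exact: yoneda_faithful.
- move=> [N Nflat]; exists (reg_smod N).
  exact: yoneda_esurj Nflat.
- by move=> [M Mc] [N Nc] g; exact: yoneda_full.
- by move=> [M Mc] [N Nc] f f'; exact: yoneda_faithful.
- move=> [[N Ncart] Nflat].
  exists (exist _ (reg_smod N) (reg_smod_cartesian Nflat Ncart)).
  exact: yoneda_esurj Nflat.
Qed.
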